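(* Let $N$ be a normal subgroup of $F_{\mathrm{br}}$. Then either $N\le P_{\mathrm{br}}$ or else $[F_{\mathrm{br}},F_{\mathrm{br}}]\le N$.
   Context: A tree means a finite rooted binary tree (every non-leaf vertex has a left and a right child; the one-vertex tree is allowed); its leaves are numbered $1,\dots,n$ from left to right. A caret is a non-leaf vertex together with its two children. $T\cup\lambda_k$ denotes the tree obtained from $T$ by attaching a caret to its $k$-th leaf. $B_n$ is the braid group on $n$ strands, drawn top to bottom, with product $bc$ meaning $b$ stacked on top of $c$; $PB_n\le B_n$ is the pure braid group. For $b\in B_n$, $\rho_b\in S_n$ sends the bottom position $k$ of a strand to its top position. The cloning map $\kappa_k^n\colon B_n\to B_{n+1}$ replaces the strand with bottom position $k$ by two parallel strands. A braided paired tree diagram is a triple $(T_-,b,T_+)$ with $T_\pm$ trees with the same number $n$ of leaves and $b\in B_n$. An expansion replaces $(T_-,b,T_+)$ by $(T_-\cup\lambda_{\rho_b(k)},\kappa_k^n(b),T_+\cup\lambda_k)$ for some $1\le k\le n$; a reduction is the reverse. Equivalence is generated by expansions and reductions, and we write $(T_-,b,T_+)$ also for its class. $V_{\mathrm{br}}$ is the set of equivalence classes, a group under the multiplication determined by $(T,b,S)(S,c,U)=(T,bc,U)$ (any two elements can be expanded so that this applies). $F_{\mathrm{br}}\le V_{\mathrm{br}}$ is the subgroup of elements $(T_-,p,T_+)$ with $p$ a pure braid. $P_{\mathrm{br}}\le F_{\mathrm{br}}$ is the subgroup of elements of the form $(T,p,T)$ with $p$ pure; it is the kernel of the natural map $F_{\mathrm{br}}\to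 F$ onto Thompson's group $F$, $(T_-,p,T_+)\mapsto (T_-,T_+)$. *)

(* Defs.v *)
From HB Require Import structures.
From Stdlib Require Import Relations.
From mathcomp Require Import all_boot fingroup perm generic_quotient zify.
From mathcomp Require Import boolp classical_sets.

Set Implicit Arguments.
Unset Strict Implicit.
Unset Printing Implicit Defensive.

Local Open Scope classical_set_scope.
Local Open Scope quotient_scope.
Local Open Scope group_scope.

Notation rst_closure R := (clos_refl_sym_trans _ R).

Section EquivalenceClosure.
Variables (T : Type) (R : relation T).

Definition rstb : rel T := fun x y => `[< rst_closure R x y >].

Lemma rstb_refl : reflexive rstb.
Proof. by move=> x; apply/asboolP; exact: rst_refl. Qed.

Lemma rstb_sym : symmetric rstb.
Proof. by move=> x y; apply/asboolP/asboolP; exact: rst_sym. Qed.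

Lemma rstb_trans : transitive rstb.
Proof.
by move=> y x z /asboolP xy /asboolP yz; apply/asboolP; exact: rst_trans yz.
Qed.

Canonical rstb_equiv := EquivRel rstb rstb_refl rstb_sym rstb_trans.

End EquivalenceClosure.

(* The letter (i, true) is the generator sigma_i exchanging the adjacent      *)
(* positions i and i + 1 (positions are numbered from 0), and (i, false) is   *)
(* its inverse. A word is read from top to bottom.                            *)
Definition word (n : nat) := seq ('I_n.-1 * bool).

HB.instance Definition _ n := Choice.on (word n).

Inductive braid_step (n : nat) : relation (word n) :=
| braid_cancel (u v : word n) i e :
    braid_step (u ++ [:: (i, e); (i, ~~ e)] ++ v) (u ++ v)
| braid_far (u v : word n) (i j : 'I_n.-1) : i.+1 < j ->
    braid_step (u ++ [:: (i, true); (j, true)] ++ v)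
               (u ++ [:: (j, true); (i, true)] ++ v)
| braid_adjacent (u v : word n) (i j : 'I_n.-1) : i.+1 = j :> nat ->
    braid_step (u ++ [:: (i, true); (j, true); (i, true)] ++ v)
               (u ++ [:: (j, true); (i, true); (j, true)] ++ v).

Definition braid (n : nat) := {eq_quot @rstb (word n) (@braid_step n)}.
HB.instance Definition _ n := Choice.on (braid n).
HB.instance Definition _ n := EqQuotient.on (braid n).

Definition word_inv n (w : word n) : word n := rev [seq (l.1, ~~ l.2) | l <- w].

Definition braid_one n : braid n := \pi_(braid n) [::].
Definition braid_mul n (b c : braid n) : braid n :=
  \pi_(braid n) (repr b ++ repr c).
Definition braid_inv n (b : braid n) : braid n :=
  \pi_(braid n) (word_inv (repr b)).

Lemma braid_eqP n (w w' : word n) :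
  reflect (rst_closure (@braid_step n) w w') (w == w' %[mod braid n]).
Proof. rewrite eqmodE; exact: asboolP. Qed.

(* A word invariant respected by the elementary moves descends to braids *)
Lemma braid_lift n (A : Type) (f : word n -> A) :
  (forall w w', braid_step w w' -> f w = f w') ->
  forall w, f (repr (\pi_(braid n) w)) = f w.
Proof.
move=> Hf w; have /eqP/braid_eqP := reprK (\pi_(braid n) w).
move: (repr _) => v; elim=> {w v} [w v|//|w v _ ->|w v u _ -> _ ->] //.
exact: Hf.
Qed.

Lemma braid_mulE n (w w' : word n) :
  braid_mul (\pi w) (\pi w') = \pi_(braid n) (w ++ w').
Proof.
transitivity (\pi_(braid n) (w ++ repr (\pi_(braid n) w'))); last first.
  apply: (braid_lift (f := fun v => \pi_(braid n) (w ++ v))) => {w'} v v' vv'.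
  apply/eqP/braid_eqP/rst_step; case: vv' => [u x i e|u x i j ij|u x i j ij];
  rewrite !(catA w); by constructor.
apply: (braid_lift (f := fun v => \pi_(braid n) (v ++ repr (\pi_(braid n) w')))).
move=> v v' vv'; apply/eqP/braid_eqP/rst_step.
case: vv' => [u x i e|u x i j ij|u x i j ij]; rewrite -!catA; by constructor.
Qed.

Lemma word_inv_cat n (u v : word n) :
  word_inv (u ++ v) = word_inv v ++ word_inv u.
Proof. by rewrite /word_inv map_cat rev_cat. Qed.

Lemma word_invK n : involutive (@word_inv n).
Proof.
move=> w; rewrite /word_inv map_rev revK -map_comp -[RHS]map_id.
by apply: eq_map => -[i e] /=; rewrite negbK.
Qed.

Lemma word_mulgV n (w : word n) : w ++ word_inv w = [::] %[mod braid n].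
Proof.
elim/last_ind: w => [//|w [i e] IH].
rewrite -cats1 word_inv_cat -IH /= -!catA /=.
by apply/eqP/braid_eqP/rst_step; exact: (braid_cancel w (word_inv w) i e).
Qed.

Section BraidGroup.
Variable n : nat.

Lemma braid_mulA : associative (@braid_mul n).
Proof.
move=> a b c; rewrite -[a]reprK -[b]reprK -[c]reprK.
by rewrite !braid_mulE catA.
Qed.
Lemma braid_mul1 : left_id (braid_one n) (@braid_mul n).
Proof. by move=> a; rewrite -[a]reprK braid_mulE. Qed.
Lemma braid_mulr1 : right_id (braid_one n) (@braid_mul n).
Proof. by move=> a; rewrite -[a]reprK braid_mulE cats0. Qed.
Lemma braid_mulgV : right_inverse (braid_one n) (@braid_inv n) (@braid_mul n).
Proof. by move=> a; rewrite -{1}[a]reprK braid_mulE word_mulgV. Qed.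
Lemma braid_mulVg : left_inverse (braid_one n) (@braid_inv n) (@braid_mul n).
Proof.
move=> a; rewrite -{2}[a]reprK braid_mulE.
by rewrite -{2}[repr a]word_invK word_mulgV.
Qed.

HB.instance Definition _ := isGroup.Build (braid n)
  braid_mulA braid_mul1 braid_mulr1 braid_mulVg braid_mulgV.
End BraidGroup.

Lemma braid_pi_cat n (w w' : word n) :
  \pi_(braid n) (w ++ w') = \pi_(braid n) w * \pi_(braid n) w'.
Proof. by rewrite -braid_mulE. Qed.

Definition lpos n (i : 'I_n.-1) : 'I_n := widen_ord (leq_pred n) i.
Definition rpos n (i : 'I_n.-1) : 'I_n := lift (lpos i) i.

(* Products in 'S_n are read from left to right, whence               *)
(* rho (b * c) = rho c * rho b, that is, rho (b * c) k = rho b (rho c k).     *)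
Definition word_perm n (w : word n) : 'S_n :=
  foldr (fun l s => s * tperm (lpos l.1) (rpos l.1)) 1 w.

(* rho and kappa do not depend on the representative: see rho_pi, kappa_pi.   *)
Definition rho n (b : braid n) : 'S_n := word_perm (repr b).

(* rho b k is the top position of the strand of b with bottom position k.     *)
(* Doubling the strand of sigma_i with bottom position i produces             *)
(* sigma_i sigma_(i+1); doubling the one with bottom position i + 1 produces  *)
(* sigma_(i+1) sigma_i; otherwise only the index of the crossing may shift,   *)
(* and lift k i is i + 1 if k <= i, and i otherwise.                          *)
Definition clone_letter n (k : 'I_n) (l : 'I_n.-1 * bool) : word n.+1 :=
  let: (i, e) := l in
  if k == lpos i then [:: (lpos i, e); (rpos i, e)]
  else if k == rpos i then [:: (rpos i, e); (lpos i, e)]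
  else [:: (lift k i, e)].

Fixpoint clone_word n (k : 'I_n) (w : word n) : word n.+1 :=
  if w is l :: w' then clone_letter (word_perm w' k) l ++ clone_word k w'
  else [::].

Definition kappa n (k : 'I_n) (b : braid n) : braid n.+1 :=
  \pi_(braid n.+1) (clone_word k (repr b)).

Definition gen n (i : nat) (e : bool) : braid n :=
  if insub i is Some i' then \pi_(braid n) [:: (i', e)] else 1.

Definition tp (i k : nat) : nat :=
  if k == i then i.+1 else if k == i.+1 then i else k.

Definition cl n (k i : nat) (e : bool) : braid n :=
  if k == i then gen n i e * gen n i.+1 e
  else if k == i.+1 then gen n i.+1 e * gen n i e
  else gen n (if k < i then i.+1 else i) e.

Lemma lposE n (i : 'I_n.-1) : lpos i = i :> nat. Proof. by []. Qed.
Lemma rposE n (i : 'I_n.-1) : rpos i = i.+1 :> nat.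
Proof. by rewrite /= /bump /= leqnn. Qed.

Lemma genE n (i : 'I_n.-1) e : gen n i e = \pi_(braid n) [:: (i, e)].
Proof. by rewrite /gen valK. Qed.

Lemma word_permE n (l : 'I_n.-1 * bool) (w : word n) k :
  word_perm (l :: w) k = tp l.1 (word_perm w k) :> nat.
Proof.
rewrite /= permM /tp; case: tpermP => [->|->|/eqP kl /eqP kr].
- by rewrite lposE eqxx rposE.
- by rewrite rposE eqxx lposE; case: eqP => // /esym/n_Sn.
- by rewrite -(lposE l.1) -(rposE l.1) !(inj_eq val_inj) (negbTE kl) (negbTE kr).
Qed.

Lemma clone_letterE n (k : 'I_n) (l : 'I_n.-1 * bool) :
  \pi_(braid n.+1) (clone_letter k l) = cl n.+1 k l.1 l.2.
Proof.
case: l => i e; have c2 (x y : 'I_n) : \pi_(braid n.+1) [:: (x, e); (y, e)] =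
  gen n.+1 x e * gen n.+1 y e.
  by rewrite -(cat1s _ [:: _]) braid_pi_cat -!(genE (n := n.+1)).
rewrite /clone_letter /cl -[k == lpos i]val_eqE -[k == rpos i]val_eqE /=.
rewrite {1}/bump leqnn add1n.
case: ifP => [_|ki]; first by rewrite c2 /= /bump leqnn.
case: ifP => [_|ki']; first by rewrite c2 /= /bump leqnn.
rewrite -(genE (n := n.+1)) /= /bump; congr gen; move: ki; case: ltngtP; lia.
Qed.

Lemma gen_out n i e : (n.-1 <= i)%N -> gen n i e = 1.
Proof. by move=> ni; rewrite /gen insubF // ltnNge ni. Qed.

Lemma gen_inv n i e : gen n i e * gen n i (~~ e) = 1.
Proof.
case: (ltnP i n.-1) => [lt_i|/gen_out E]; last by rewrite !E mulg1.
rewrite -[i]/(val (Ordinal lt_i)) !genE -braid_pi_cat.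
apply/eqP/braid_eqP/rst_step; exact: (braid_cancel [::] [::]).
Qed.

Lemma gen_false n i : gen n i false = (gen n i true)^-1.
Proof. by apply: (mulgI (gen n i true)); rewrite gen_inv mulgV. Qed.

Lemma gen_far n i j e e' : i.+1 < j -> commute (gen n i e) (gen n j e').
Proof.
move=> ij; suff C : commute (gen n i true) (gen n j true).
  case: e; case: e'; rewrite ?gen_false //.
  - exact: commuteV.
  - exact/commute_sym/commuteV/commute_sym.
  - exact/commuteV/commute_sym/commuteV/commute_sym.
case: (ltnP j n.-1) => [lt_j|/gen_out E]; last by rewrite /commute !E mulg1 mul1g.
have lt_i : i < n.-1 by lia.
rewrite /commute -[i]/(val (Ordinal lt_i)) -[j]/(val (Ordinal lt_j)) !genE.
rewrite -!braid_pi_cat.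
by apply/eqP/braid_eqP/rst_step; exact: (braid_far [::] [::]).
Qed.

Lemma gen_adj n i : i.+1 < n.-1 ->
  gen n i true * gen n i.+1 true * gen n i true =
  gen n i.+1 true * gen n i true * gen n i.+1 true.
Proof.
move=> lt_j; have lt_i : i < n.-1 by lia.
rewrite -[i.+1]/(val (Ordinal lt_j)) -[i]/(val (Ordinal lt_i)) !genE.
rewrite -!braid_pi_cat.
by apply/eqP/braid_eqP/rst_step; exact: (braid_adjacent [::] [::]).
Qed.

Lemma word_perm_cat n (u v : word n) :
  word_perm (u ++ v) = word_perm v * word_perm u.
Proof. by elim: u => [|l u IH] /=; rewrite ?mulg1 // IH mulgA. Qed.

Lemma clone_word_cat n (k : 'I_n) (u v : word n) :
  clone_word k (u ++ v) = clone_word (word_perm v k) u ++ clone_word k v.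
Proof.
by elim: u => [//|l u IH] /=; rewrite IH catA word_perm_cat permM.
Qed.

Lemma tpK i : involutive (tp i).
Proof. by move=> k; rewrite /tp; do ![case: eqP => //=]; lia. Qed.

Lemma word_perm_step n (w w' : word n) :
  braid_step w w' -> word_perm w = word_perm w'.
Proof.
have cong (u v L R : word n) : word_perm L = word_perm R ->
    word_perm (u ++ L ++ v) = word_perm (u ++ R ++ v).
  by move=> LR; rewrite !word_perm_cat LR.
case=> [u v i e|u v i j ij|u v i j ij];
  [apply: (cong u v _ [::])|apply: cong|apply: cong];
  apply/permP=> k; apply: ord_inj; rewrite !word_permE /= !perm1 /=.
- exact: tpK.
- by rewrite /tp; do ![case: eqP => //=]; lia.
- by rewrite -ij /tp; do ![case: eqP => //=]; lia.
Qed.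

Lemma clone_wordE n (k : 'I_n) l (w : word n) :
  \pi_(braid n.+1) (clone_word k (l :: w)) =
  cl n.+1 (word_perm w k) l.1 l.2 * \pi_(braid n.+1) (clone_word k w).
Proof. by rewrite /= braid_pi_cat clone_letterE. Qed.

Local Ltac dec := repeat (match goal with
  | |- context [@eq_op _ ?a ?b] =>
    first [rewrite (_ : (a == b) = true); [|lia]
          |rewrite (_ : (a == b) = false); [|lia]]
  | |- context [leq ?a ?b] =>
    first [rewrite (_ : leq a b = true); [|lia]
          |rewrite (_ : leq a b = false); [|lia]]
  end; cbn iota).

Lemma gen_invr n i e : gen n i (~~ e) = (gen n i e)^-1.
Proof. by apply: (mulgI (gen n i e)); rewrite gen_inv mulgV. Qed.

Lemma cl_cancel n k i e : cl n (tp i k) i e * cl n k i (~~ e) = 1.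
Proof.
rewrite /cl /tp !gen_invr.
have [ki|ki|ki] := ltngtP k i; last by subst; dec; rewrite !mulgA mulgK mulgV.
  by dec; rewrite mulgV.
have [ki'|ki'|ki'] := ltngtP k i.+1; [lia| |].
  by dec; rewrite mulgV.
by subst; dec; rewrite !mulgA mulgK mulgV.
Qed.

Lemma cl_far n k i j : i.+1 < j ->
  cl n (tp j k) i true * cl n k j true = cl n (tp i k) j true * cl n k i true.
Proof.
move=> ij; rewrite /cl /tp.
have far1 a b c : a.+1 < b -> a.+1 < c ->
    gen n a true * (gen n b true * gen n c true) =
    gen n b true * gen n c true * gen n a true.
  by move=> ab ac; apply: commuteM; exact: gen_far.
have far2 a b c : a.+1 < c -> b.+1 < c ->
    gen n a true * gen n b true * gen n c true =
    gen n c true * (gen n a true * gen n b true).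
  by move=> ab ac; symmetry; apply: commuteM; exact/commute_sym/gen_far.
have far0 a b : a.+1 < b ->
    gen n a true * gen n b true = gen n b true * gen n a true.
  by move=> ab; exact: gen_far.
have [ki|ki|ki] := ltngtP k i.
- by dec; exact: far0.
- have [ki'|ki'|ki'] := ltngtP k i.+1; [lia| |].
  + have [kj|kj|kj] := ltngtP k j.
    * by dec; apply: far0; lia.
    * have [kj'|kj'|kj'] := ltngtP k j.+1; [lia| |].
        by dec; apply: far0; lia.
      by subst; dec; apply: far1; lia.
    * by subst; dec; apply: far1; lia.
  + by subst; dec; apply: far2; lia.
- by subst; dec; apply: far2; lia.
Qed.

Section BraidIdentities.
Variables (G : groupType) (a b c : G).
Hypotheses (A : a * b * a = b * a * b) (B : b * c * b = c * b * c).
Hypothesis (C : a * c = c * a).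

Lemma braid_identity1 : a * (b * c * (a * b)) = b * c * (a * b * c).
Proof.
rewrite !mulgA -(mulgA _ c a) -C !mulgA A -!mulgA (mulgA b c b) B !mulgA.
by rewrite -(mulgA _ a c) C !mulgA.
Qed.

Lemma braid_identity2 : a * b * (c * (b * a)) = c * b * (a * (b * c)).
Proof.
rewrite -!mulgA (mulgA b c) (mulgA _ b a) B !mulgA C -!mulgA -C.
by rewrite (mulgA a b) (mulgA _ a c) A !mulgA.
Qed.

Lemma braid_identity3 : b * a * (c * b * a) = c * (b * a * (c * b)).
Proof.
rewrite -!mulgA (mulgA a c) C -!mulgA (mulgA a b a) A !mulgA B.
by rewrite -(mulgA _ c a) -C !mulgA.
Qed.
End BraidIdentities.

Lemma cl_adj n k i : i.+2 < n.-1 ->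
  cl n (tp i.+1 (tp i k)) i true * (cl n (tp i k) i.+1 true * cl n k i true) =
  cl n (tp i (tp i.+1 k)) i.+1 true * (cl n (tp i.+1 k) i true * cl n k i.+1 true).
Proof.
move=> lt_i; rewrite /cl /tp.
have A := @gen_adj n i (ltnW lt_i).
have B := @gen_adj n i.+1 lt_i.
have C : gen n i true * gen n i.+2 true = gen n i.+2 true * gen n i true.
  by apply: gen_far.
have [ki|ki|ki] := ltngtP k i.
- by dec; rewrite !mulgA.
- have [ki'|ki'|ki'] := ltngtP k i.+1; [lia| |].
  + have [ki2|ki2|ki2] := ltngtP k i.+2; [lia| |].
      by dec; rewrite !mulgA.
    subst; dec; exact: braid_identity3 A B C.
  + by subst; dec; exact: braid_identity2 A B C.
- by subst; dec; exact: braid_identity1 A B C.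
Qed.

Lemma clone_step n (w w' : word n) (k : 'I_n) : braid_step w w' ->
  \pi_(braid n.+1) (clone_word k w) = \pi_(braid n.+1) (clone_word k w').
Proof.
have cong (u v L R : word n) (m : 'I_n) : braid_step L R ->
    (forall k, \pi_(braid n.+1) (clone_word k L) = \pi_(braid n.+1) (clone_word k R)) ->
    \pi_(braid n.+1) (clone_word m (u ++ L ++ v)) =
    \pi_(braid n.+1) (clone_word m (u ++ R ++ v)).
  move=> /word_perm_step E LR; rewrite !clone_word_cat !braid_pi_cat LR.
  by rewrite !word_perm_cat E.
case=> [u v i e|u v i j ij|u v i j ij].
- apply: (cong u v _ [::]) => [|m]; first exact: (braid_cancel [::] [::]).
  rewrite !clone_wordE mulg1 perm1 word_permE perm1; exact: cl_cancel.
- apply: cong => [|m]; first exact: (braid_far [::] [::]).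
  rewrite !clone_wordE !mulg1 !perm1 !word_permE !perm1; exact: cl_far.
- apply: cong => [|m]; first exact: (braid_adjacent [::] [::]).
  rewrite !clone_wordE !mulg1 !perm1 !word_permE !perm1 /= -ij.
  by apply: cl_adj; move: (ltn_ord j); lia.
Qed.

Lemma rho_pi n (w : word n) : rho (\pi_(braid n) w) = word_perm w.
Proof. by apply: braid_lift => {}w w'; exact: word_perm_step. Qed.

Lemma kappa_pi n (k : 'I_n) (w : word n) :
  kappa k (\pi_(braid n) w) = \pi_(braid n.+1) (clone_word k w).
Proof.
apply: (braid_lift (f := fun w => \pi_(braid n.+1) (clone_word k w))).
by move=> {}w w'; exact: clone_step.
Qed.

Lemma rho1 n : rho (1 : braid n) = 1.
Proof. exact: rho_pi. Qed.

Lemma rhoM n (b c : braid n) : rho (b * c) = rho c * rho b.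
Proof.
rewrite -[b]reprK -[c]reprK -braid_pi_cat !rho_pi; exact: word_perm_cat.
Qed.

Lemma kappa1 n (k : 'I_n) : kappa k (1 : braid n) = 1.
Proof. exact: kappa_pi. Qed.

Lemma kappaM n (k : 'I_n) (b c : braid n) :
  kappa k (b * c) = kappa (rho c k) b * kappa k c.
Proof.
rewrite -[b]reprK -[c]reprK -braid_pi_cat rho_pi !kappa_pi.
by rewrite clone_word_cat braid_pi_cat.
Qed.

Lemma rhoV n (b : braid n) : rho b^-1 = (rho b)^-1.
Proof. by apply: (mulgI (rho b)); rewrite -rhoM mulVg rho1 mulgV. Qed.

Lemma kappaV n (k : 'I_n) (b : braid n) :
  kappa (rho b k) b^-1 = (kappa k b)^-1.
Proof. by apply: (mulIg (kappa k b)); rewrite -kappaM !mulVg kappa1. Qed.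

Lemma braid_ind n (P : braid n -> Prop) : P 1 ->
  (forall l b, P b -> P (\pi_(braid n) [:: l] * b)) -> forall b, P b.
Proof.
move=> P1 PM b; rewrite -[b]reprK; elim: (repr b) => [//|l w IH].
by rewrite -cat1s braid_pi_cat; exact: PM.
Qed.

Definition wid n (k : 'I_n) : 'I_n.+1 := widen_ord (leqnSn n) k.

Lemma rho_gen n i e (k : 'I_n) : i < n.-1 -> rho (gen n i e) k = tp i k :> nat.
Proof.
move=> lt_i; rewrite -[i]/(val (Ordinal lt_i)) genE rho_pi word_permE /=.
by rewrite perm1.
Qed.

Lemma kappa_gen n i e (k : 'I_n) : i < n.-1 ->
  kappa k (gen n i e) = cl n.+1 k i e.
Proof.
move=> lt_i; rewrite -[i]/(val (Ordinal lt_i)) genE kappa_pi clone_wordE.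
by rewrite /= mulg1 perm1.
Qed.

Definition tcl (k i m : nat) : nat :=
  if k == i then tp i (tp i.+1 m)
  else if k == i.+1 then tp i.+1 (tp i m)
  else tp (if k < i then i.+1 else i) m.

Definition kcl n (m k i : nat) e : braid n :=
  if k == i then cl n (tp i.+1 m) i e * cl n m i.+1 e
  else if k == i.+1 then cl n (tp i m) i.+1 e * cl n m i e
  else cl n m (if k < i then i.+1 else i) e.

Lemma rho_cl n k i e (m : 'I_n.+1) : i < n.-1 ->
  rho (cl n.+1 k i e) m = tcl k i m :> nat.
Proof.
move=> lt_i; rewrite /cl /tcl.
by do !case: ifP => _; rewrite ?rhoM ?permM !rho_gen //=; lia.
Qed.

Lemma kappa_cl n k i e (m : 'I_n.+1) : i < n.-1 ->
  kappa m (cl n.+1 k i e) = kcl n.+2 m k i e.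
Proof.
move=> lt_i; rewrite /cl /kcl.
by do !case: ifP => _; rewrite ?kappaM !kappa_gen ?rho_gen //=; lia.
Qed.

Lemma tcl_bump k l i : tcl k i (bump k l) = bump (tp i k) (tp i l).
Proof.
rewrite /tcl /tp /bump; do ![case: ifP]; lia.
Qed.

Lemma kcl_bump_lt n k l i e : k < l -> kcl n l.+1 k i e = kcl n k l i e.
Proof.
move=> kl; rewrite /kcl /cl /tp.
have [ki|ki|ki] := ltngtP k i.
- have [li|li|li] := ltngtP l i; first by dec.
    have [li'|li'|li'] := ltngtP l i.+1; [lia|by dec|by subst; dec].
  by subst; dec.
- have [ki'|ki'|ki'] := ltngtP k i.+1; [lia|by dec|by subst; dec].
- have [li'|li'|li'] := ltngtP l i.+1; [lia|by subst; dec|].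
  subst; dec; rewrite -!mulgA; congr (_ * _); rewrite !mulgA; congr (_ * _).
  exact: gen_far.
Qed.

Lemma kcl_bump n k l i e : k != l ->
  kcl n (bump k l) k i e = kcl n (bump l k) l i e.
Proof.
rewrite neq_ltn /bump => /orP[kl|lk].
  by rewrite (ltnW kl) leqNgt kl; exact: kcl_bump_lt.
by rewrite (ltnW lk) [k <= l]leqNgt lk; symmetry; exact: kcl_bump_lt.
Qed.

Lemma rho_kappa n (k l : 'I_n) (b : braid n) :
  rho (kappa k b) (lift (wid k) l) = lift (wid (rho b k)) (rho b l).
Proof.
elim/braid_ind: b => [|[i e] b IH].
  by rewrite kappa1 !rho1 !perm1.
apply: ord_inj; rewrite kappaM !rhoM !permM IH kappa_pi clone_wordE /=.
rewrite mulg1 perm1 rho_cl //= tcl_bump -genE.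
by congr bump; rewrite rho_gen.
Qed.

Lemma kappa_kappa n (k l : 'I_n) (b : braid n) : k != l ->
  kappa (lift (wid k) l) (kappa k b) = kappa (lift (wid l) k) (kappa l b).
Proof.
move=> kl; elim/braid_ind: b => [|[i e] b IH].
  by rewrite !kappa1.
rewrite !kappaM IH !rho_kappa; congr (_ * _).
rewrite -!genE !kappa_gen // !kappa_cl //=; apply: kcl_bump.
by rewrite val_eqE (inj_eq perm_inj).
Qed.

Inductive tree : predArgType := Leaf | Node of tree & tree.

HB.instance Definition _ := gen_eqMixin tree.
HB.instance Definition _ := gen_choiceMixin tree.

Fixpoint leaves (T : tree) : nat :=
  if T is Node L R then leaves L + leaves R else 1.

(* Leaves are numbered from 0; only the values k < leaves T are relevant.     *)
Fixpoint attach (T : tree) (k : nat) : tree :=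
  if T is Node L R then
    if k < leaves L then Node (attach L k) R else Node L (attach R (k - leaves L))
  else Node Leaf Leaf.

Lemma leaves_attach T k : leaves (attach T k) = (leaves T).+1.
Proof.
elim: T k => [//|L IHL R IHR] k /=.
by case: ifP => _ /=; rewrite ?IHL ?IHR ?addSn ?addnS.
Qed.

Lemma leaves_gt0 T : 0 < leaves T.
Proof. by elim: T => //= L IHL R IHR; rewrite addn_gt0 IHL. Qed.

Lemma attachC T k l : k != l -> k < leaves T -> l < leaves T ->
  attach (attach T k) (bump k l) = attach (attach T l) (bump l k).
Proof.
elim: T k l => [|L IHL R IHR] k l kl /= kT lT.
  by move: kl kT lT; case: k l => [|k] [|l].
case: (ltnP k (leaves L)) => kL; case: (ltnP l (leaves L)) => lL /=;
  rewrite ?leaves_attach.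
- have -> : bump k l < (leaves L).+1 by rewrite /bump; lia.
  have -> : bump l k < (leaves L).+1 by rewrite /bump; lia.
  by rewrite IHL.
- have -> : (bump k l < (leaves L).+1) = false by rewrite /bump; lia.
  have -> : (bump l k < leaves L) by rewrite /bump; lia.
  by congr (Node (attach _ _) (attach _ _)); rewrite /bump; lia.
- have -> : (bump k l < leaves L) by rewrite /bump; lia.
  have -> : (bump l k < (leaves L).+1) = false by rewrite /bump; lia.
  by congr (Node (attach _ _) (attach _ _)); rewrite /bump; lia.
- have -> : (bump k l < leaves L) = false by rewrite /bump; lia.
  have -> : (bump l k < leaves L) = false by rewrite /bump; lia.
  have E x y : leaves L <= x -> leaves L <= y ->
      bump x y - leaves L = bump (x - leaves L) (y - leaves L).
    by rewrite /bump; lia.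
  by rewrite !E // IHR //; lia.
Qed.

Fixpoint subtree (S T : tree) : bool :=
  match S, T with
  | Leaf, _ => true
  | Node A B, Node C D => subtree A C && subtree B D
  | _, _ => false
  end.

Fixpoint join (S T : tree) : tree :=
  match S, T with
  | Leaf, _ => T
  | _, Leaf => S
  | Node A B, Node C D => Node (join A C) (join B D)
  end.

Lemma subtree_refl T : subtree T T.
Proof. by elim: T => //= L -> R ->. Qed.

Lemma subtree_trans S T U : subtree S T -> subtree T U -> subtree S U.
Proof.
elim: S T U => [//|A IHA B IHB] [//|C D] [//|E F] /= /andP[AC BD] /andP[CE DF].
by rewrite (IHA _ _ AC CE) (IHB _ _ BD DF).
Qed.

Lemma subtree_joinl S T : subtree S (join S T).
Proof.
elim: S T => [//|A IHA B IHB] [|C D] /=; first by rewrite !subtree_refl.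
by rewrite IHA IHB.
Qed.

Lemma subtree_joinr S T : subtree T (join S T).
Proof.
elim: S T => [|A IHA B IHB] [|C D] //=; first by rewrite !subtree_refl.
by rewrite IHA IHB.
Qed.

Lemma subtree_attach T k : subtree T (attach T k).
Proof.
elim: T k => [//|L IHL R IHR] k /=.
by case: ifP => _ /=; rewrite ?IHL ?IHR !subtree_refl.
Qed.

Lemma subtree_leaves S T : subtree S T -> leaves S <= leaves T.
Proof.
elim: S T => [|A IHA B IHB] [|C D] //=; first by rewrite addn_gt0 leaves_gt0.
by move=> /andP[/IHA AC /IHB BD]; exact: leq_add.
Qed.

Lemma subtree_grow S T : subtree S T -> S <> T ->
  exists2 k, k < leaves S & subtree (attach S k) T.
Proof.
elim: S T => [|A IHA B IHB] [|C D] //=; first by move=> _ _; exists 0.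
move=> /andP[AC BD] ne; have [eAC|neAC] := pselect (A = C).
  have neBD : B <> D by move=> eBD; apply: ne; rewrite eAC eBD.
  have [k kB sB] := IHB _ BD neBD; exists (leaves A + k); first by rewrite ltn_add2l.
  by rewrite ltnNge leq_addr /= AC addKn.
have [k kA sA] := IHA _ AC neAC; exists k; first exact: ltn_addr.
by rewrite kA /= sA.
Qed.

Lemma subtree_attach2 S T k l : k != l -> k < leaves S -> l < leaves S ->
  subtree (attach S k) T -> subtree (attach S l) T ->
  subtree (attach (attach S k) (bump k l)) T.
Proof.
elim: S T k l => [|A IHA B IHB] T k l kl /= kS lS.
  by move: kl kS lS; case: k l => [|k] [|l].
case: (ltnP k (leaves A)) => kA; case: (ltnP l (leaves A)) => lA;
  case: T => [//|C D] /= /andP[h1 h2] /andP[h3 h4]; rewrite ?leaves_attach.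
- have -> : bump k l < (leaves A).+1 by rewrite /bump; lia.
  by rewrite /= IHA.
- have -> : (bump k l < (leaves A).+1) = false by rewrite /bump; lia.
  rewrite /= h1; suff -> : bump k l - (leaves A).+1 = l - leaves A by [].
  by rewrite /bump; lia.
- have -> : (bump k l < leaves A) by rewrite /bump; lia.
  rewrite /= h2 andbT; suff -> : bump k l = l by [].
  by rewrite /bump; lia.
- have -> : (bump k l < leaves A) = false by rewrite /bump; lia.
  have -> : bump k l - leaves A = bump (k - leaves A) (l - leaves A).
    by rewrite /bump; lia.
  by rewrite /= h1 IHB //; lia.
Qed.

Definition ntree (n : nat) := {T : tree | leaves T == n}.

Lemma nattach_subproof n (T : ntree n) k : leaves (attach (val T) k) == n.+1.
Proof. by rewrite leaves_attach (eqP (valP T)). Qed.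

Definition nattach n (T : ntree n) (k : 'I_n) : ntree n.+1 :=
  exist _ (attach (val T) k) (nattach_subproof T k).

Definition diagram := {n : nat & (ntree n * braid n * ntree n)%type}.

Definition diag n (T : ntree n) (b : braid n) (S : ntree n) : diagram :=
  Tagged (fun n => (ntree n * braid n * ntree n)%type) (T, b, S).

Inductive expansion : relation diagram :=
| Expansion n (T : ntree n) (b : braid n) (S : ntree n) (k : 'I_n) :
    expansion (diag T b S)
              (diag (nattach T (rho b k)) (kappa k b) (nattach S k)).

Definition Vbr := {eq_quot @rstb diagram expansion}.
HB.instance Definition _ := Choice.on Vbr.
HB.instance Definition _ := EqQuotient.on Vbr.

Definition Vclass n (T : ntree n) (b : braid n) (S : ntree n) : Vbr :=
  \pi_Vbr (diag T b S).

Definition Vmul_spec (x y z : Vbr) : Prop :=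
  exists n (T S U : ntree n) (b c : braid n),
    [/\ x = Vclass T b S, y = Vclass S c U & z = Vclass T (b * c) U].

Definition leaf_tree : ntree 1 := exist _ Leaf (eqxx 1%N).
Definition Vone : Vbr := Vclass leaf_tree 1 leaf_tree.
(* VmulE below shows that Vmul_spec x y holds for exactly one element.        *)
Definition Vmul (x y : Vbr) : Vbr := xget Vone (Vmul_spec x y).

Definition dinv (x : diagram) : diagram :=
  let: existT n (T, b, U) := x in diag U b^-1 T.
Definition Vinv (x : Vbr) : Vbr := \pi_Vbr (dinv (repr x)).

Definition dleft (x : diagram) : tree := val (tagged x).1.1.
Definition dright (x : diagram) : tree := val (tagged x).2.

Local Notation expand := (clos_refl_trans_1n _ expansion).

Lemma ntree_size n m (T : ntree n) (U : ntree m) : val T = val U -> n = m.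
Proof. by move=> TU; rewrite -(eqP (valP U)) -TU (eqP (valP T)). Qed.

Lemma expand_trans x y z : expand x y -> expand y z -> expand x z.
Proof.
by elim=> [//|{}x x' {}y xx' _ IH yz]; exact: Relation_Operators.rt1n_trans xx' (IH yz).
Qed.

Lemma expand1 x y : expansion x y -> expand x y.
Proof. by move=> xy; exact: Relation_Operators.rt1n_trans xy (rt1n_refl _ _ _). Qed.

Lemma dinvK : involutive dinv.
Proof. by case=> n [[T b] S]; rewrite /dinv /= invgK. Qed.

Lemma expansion_inv x y : expansion x y -> expansion (dinv x) (dinv y).
Proof.
case=> n T b S k; rewrite /dinv /=.
have := Expansion S b^-1 T (rho b k).
by rewrite rhoV permK kappaV.
Qed.

Lemma expand_inv x y : expand x y -> expand (dinv x) (dinv y).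
Proof.
elim=> [?|? ? ? /expansion_inv xx' _ IH]; first exact: rt1n_refl.
exact: Relation_Operators.rt1n_trans xx' IH.
Qed.

Lemma dleft_inv x : dleft (dinv x) = dright x.
Proof. by case: x => n [[T b] S]. Qed.
Lemma dright_inv x : dright (dinv x) = dleft x.
Proof. by case: x => n [[T b] S]. Qed.

Lemma expansion_right x y : expansion x y -> exists2 k,
  k < leaves (dright x) & dright y = attach (dright x) k.
Proof.
by case=> n T b S k; exists k => //; rewrite /dright /= (eqP (valP S)).
Qed.

Lemma expand_right x y : expand x y -> subtree (dright x) (dright y).
Proof.
elim=> [?|? ? ? /expansion_right[k _ E] _]; first exact: subtree_refl.
by apply: subtree_trans; rewrite E; exact: subtree_attach.
Qed.

Lemma expand_left x y : expand x y -> subtree (dleft x) (dleft y).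
Proof. by move/expand_inv/expand_right; rewrite !dright_inv. Qed.

Lemma expand_to_right x S : subtree (dright x) S ->
  exists2 y, expand x y & dright y = S.
Proof.
have [m] := ubnP (leaves S - leaves (dright x)).
elim: m x => // m IH [n [[T b] U]] mS sub.
have [<-|ne] := pselect (dright (diag T b U) = S).
  by exists (diag T b U) => //; exact: rt1n_refl.
have [k kU subk] := subtree_grow sub ne.
rewrite /dright /= (eqP (valP U)) in kU.
have st := Expansion T b U (Ordinal kU).
have sub' : subtree (dright (diag (nattach T (rho b (Ordinal kU)))
  (kappa (Ordinal kU) b) (nattach U (Ordinal kU)))) S by exact: subk.
have [|y xy yS] := IH _ _ sub'.
  have := subtree_leaves subk; move: mS; rewrite /dright /= leaves_attach; lia.
by exists y => //; exact: Relation_Operators.rt1n_trans st xy.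
Qed.

Lemma expand_to_left x S : subtree (dleft x) S ->
  exists2 y, expand x y & dleft y = S.
Proof.
rewrite -dright_inv => /expand_to_right[y /expand_inv]; rewrite dinvK => xy yS.
by exists (dinv y); rewrite ?dleft_inv.
Qed.

Definition dexp n (T : ntree n) (b : braid n) (U : ntree n) (k : 'I_n) : diagram :=
  diag (nattach T (rho b k)) (kappa k b) (nattach U k).

Lemma expansionP n (T : ntree n) (b : braid n) (U : ntree n) x :
  expansion (diag T b U) x -> exists k, x = dexp T b U k.
Proof.
move E : (diag T b U) => y xy; case: xy T b U E => m T' b' U' k T b U E.
have e : n = m := f_equal tag E.
subst m; have /eqP := E; rewrite eq_Tagged => /eqP[-> -> ->].
by exists k.
Qed.

Lemma dexpC n (T : ntree n) (b : braid n) (U : ntree n) (k l : 'I_n) : k != l ->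
  dexp (nattach T (rho b k)) (kappa k b) (nattach U k) (lift (wid k) l) =
  dexp (nattach T (rho b l)) (kappa l b) (nattach U l) (lift (wid l) k).
Proof.
move=> kl; have aC (W : ntree n) (i j : 'I_n) : i != j ->
    nattach (nattach W i) (lift (wid i) j) = nattach (nattach W j) (lift (wid j) i).
  by move=> ij; apply: val_inj; apply: attachC; rewrite ?(eqP (valP W)).
rewrite /dexp kappa_kappa // !rho_kappa (aC U k l kl).
by rewrite (aC T (rho b k) (rho b l)) // (inj_eq perm_inj).
Qed.

Lemma expansion_diamond x y z W : expansion x y -> expansion x z ->
  subtree (dright y) W -> subtree (dright z) W ->
  y = z \/ exists w, [/\ expansion y w, expansion z w & subtree (dright w) W].
Proof.
case: x => n [[T b] U] /expansionP[k ->] /expansionP[l ->] kW lW.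
have [->|kl] := eqVneq k l; [by left | right].
exists (dexp (nattach T (rho b k)) (kappa k b) (nattach U k) (lift (wid k) l)).
split; first exact: Expansion.
  by rewrite dexpC //; exact: Expansion.
by apply: subtree_attach2 => //; rewrite (eqP (valP U)).
Qed.

Lemma expand_right_inj x y z : expand x y -> expand x z ->
  dright y = dright z -> y = z.
Proof.
have [m] := ubnP (leaves (dright y) - leaves (dright x)).
elim: m x y z => // m IH x y z mS xy xz yz.
have E u v : expansion u v -> leaves (dright v) = (leaves (dright u)).+1.
  by move=> /expansion_right[k _ ->]; rewrite leaves_attach.
case: xy mS yz => [|x1 y' xx1 x1y] mS yz.
  case: xz yz => [//|x2 z' /E Ex /expand_right/subtree_leaves].
  by move=> h e; move: h; rewrite -e Ex ltnn.
case: xz yz => [|x2 z' xx2 x2z] yz.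
  by have /expand_right/subtree_leaves := x1y; rewrite yz (E _ _ xx1) ltnn.
have s1 := expand_right x1y; have s2 := expand_right x2z; rewrite -yz in s2.
have l1 := E _ _ xx1; have l2 := E _ _ xx2.
have l1' := subtree_leaves s1.
have [e|[w [x1w x2w ws]]] := expansion_diamond xx1 xx2 s1 s2.
  by subst x2; apply: (IH x1) => //; lia.
have [v wv vS] := expand_to_right ws.
transitivity v.
  by apply: (IH x1); [lia| |exact: Relation_Operators.rt1n_trans x1w wv|].
symmetry; apply: (IH x2); [|exact: x2z|exact: Relation_Operators.rt1n_trans x2w wv|].
  by rewrite -yz; lia.
by rewrite vS.
Qed.

Lemma expand_left_inj x y z : expand x y -> expand x z ->
  dleft y = dleft z -> y = z.
Proof.
move=> xy xz yz; apply: (can_inj dinvK).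
by apply: (expand_right_inj (expand_inv xy) (expand_inv xz)); rewrite !dright_inv.
Qed.

Lemma VeqP x y : \pi_Vbr x = \pi_Vbr y -> exists2 z, expand x z & expand y z.
Proof.
move/eqP; rewrite eqmodE => /asboolP; elim.
- by move=> u v uv; exists v; [exact: expand1|exact: rt1n_refl].
- by move=> u; exists u; exact: rt1n_refl.
- by move=> u v _ [w uw vw]; exists w.
move=> u v w _ [a ua va] _ [b vb wb].
have [a' aa' ra] := expand_to_right (subtree_joinl (dright a) (dright b)).
have [b' bb' rb] := expand_to_right (subtree_joinr (dright a) (dright b)).
have e : a' = b'.
  apply: (expand_right_inj (expand_trans va aa') (expand_trans vb bb')).
  by rewrite ra rb.
exists a'; first exact: expand_trans ua aa'.
by rewrite e; exact: expand_trans wb bb'.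
Qed.

Lemma Vexpand x y : expand x y -> \pi_Vbr x = \pi_Vbr y.
Proof.
elim=> [//|u v w uv _ <-]; apply/eqP; rewrite eqmodE; apply/asboolP.
exact: rst_step.
Qed.

Inductive composable : diagram -> diagram -> diagram -> Prop :=
| Composable n (T S U : ntree n) (b c : braid n) :
    composable (diag T b S) (diag S c U) (diag T (b * c) U).

Lemma composableP x y : dright x = dleft y -> exists z, composable x y z.
Proof.
case: x y => [n [[T b] S]] [m [[S' c] U]]; rewrite /dright /dleft /= => E.
have nm : n = m := ntree_size E.
subst m; have /val_inj e := E; subst S'; by exists (diag T (b * c) U).
Qed.

Lemma composable_eq x y z : composable x y z -> dright x = dleft y.
Proof. by case. Qed.

Lemma composable_inj x y z z' : composable x y z -> composable x y z' -> z = z'.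
Proof.
case=> n T U W b c; move E : (diag T b U) => x'; move F : (diag U c W) => y' c'.
case: c' E F => m T' U' W' b' c' E F.
have e : n = m := f_equal tag E.
subst m; move/eqP: E; rewrite eq_Tagged => /eqP[-> -> _].
by move/eqP: F; rewrite eq_Tagged => /eqP[_ -> ->].
Qed.

Lemma composable_expansion x y z x' : composable x y z -> expansion x x' ->
  exists y' z', [/\ expansion y y', expansion z z' & composable x' y' z'].
Proof.
case=> n T U W b c /expansionP[k ->]; pose j := (rho c)^-1 k.
have kE : k = rho c j by rewrite /j permKV.
exists (dexp U c W j), (dexp T (b * c) W j); split; try exact: Expansion.
rewrite /dexp kE rhoM permM kappaM; exact: Composable.
Qed.

Lemma composable_expand x y z x' y' : composable x y z ->
  expand x x' -> expand y y' -> dright x' = dleft y' ->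
  exists2 z', expand z z' & composable x' y' z'.
Proof.
move=> xyz xx'; elim: xx' y z y' xyz => {x x'} [x|x x1 x' xx1 x1x' IH] y z y' xyz yy' e.
  exists z; first exact: rt1n_refl.
  suff <- : y = y' by [].
  apply: (expand_left_inj (rt1n_refl _ _ _) yy').
  by rewrite -e (composable_eq xyz).
have [y1 [z1 [yy1 zz1 c1]]] := composable_expansion xyz xx1.
have sub : subtree (dleft y1) (dleft y').
  by rewrite -e -(composable_eq c1); exact: expand_right.
have [y2 y12 ly2] := expand_to_left sub.
have e2 : y2 = y'.
  exact: (expand_left_inj (Relation_Operators.rt1n_trans _ _ _ _ _ yy1 y12) yy').
subst y2; have [z' z1z' c'] := IH _ _ _ c1 y12 e.
by exists z' => //; exact: Relation_Operators.rt1n_trans zz1 z1z'.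
Qed.

Lemma Vmul_uniq x y z x' y' z' : composable x y z -> composable x' y' z' ->
  \pi_Vbr x = \pi_Vbr x' -> \pi_Vbr y = \pi_Vbr y' -> \pi_Vbr z = \pi_Vbr z'.
Proof.
move=> c c' /VeqP[a xa x'a] /VeqP[b yb y'b].
have [a' aa' ra] := expand_to_right (subtree_joinl (dright a) (dleft b)).
have [b' bb' rb] := expand_to_left (subtree_joinr (dright a) (dleft b)).
have ab : dright a' = dleft b' by rewrite ra rb.
have [w zw cw] := composable_expand c (expand_trans xa aa') (expand_trans yb bb') ab.
have [w' zw' cw'] := composable_expand c' (expand_trans x'a aa') (expand_trans y'b bb') ab.
by rewrite (Vexpand zw) (Vexpand zw') (composable_inj cw cw').
Qed.

Lemma VmulE n (T S U : ntree n) (b c : braid n) :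
  Vmul (Vclass T b S) (Vclass S c U) = Vclass T (b * c) U.
Proof.
apply: xget_unique; first by exists n, T, S, U, b, c.
move=> z [m [T' [S' [U' [b' [c' [e1 e2 ->]]]]]]].
exact: (Vmul_uniq (Composable T' S' U' b' c') (Composable T S U b c)).
Qed.

Lemma Vmul_composable x y z : composable x y z ->
  Vmul (\pi_Vbr x) (\pi_Vbr y) = \pi_Vbr z.
Proof. by case=> n T S U b c; exact: VmulE. Qed.

Lemma Vrep2 (x y : Vbr) : exists n (T S U : ntree n) (b c : braid n),
  x = Vclass T b S /\ y = Vclass S c U.
Proof.
have [a xa ra] := expand_to_right (subtree_joinl (dright (repr x)) (dleft (repr y))).
have [b yb lb] := expand_to_left (subtree_joinr (dright (repr x)) (dleft (repr y))).
have [z] := composableP (etrans ra (esym lb)).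
rewrite -[x]reprK -[y]reprK (Vexpand xa) (Vexpand yb) => -[n T S U c d].
by exists n, T, S, U, c, d.
Qed.

Lemma composableP2 x y z : dright x = dleft y -> dright y = dleft z ->
  exists n (T S U W : ntree n) (b c d : braid n),
    [/\ x = diag T b S, y = diag S c U & z = diag U d W].
Proof.
case: x y z => [n [[T b] S]] [m [[S' c] U]] [p [[U' d] W]].
rewrite /dright /dleft /= => E F.
have nm : n = m := ntree_size E.
have mp : m = p := ntree_size F.
subst m p; move/val_inj: E => E; move/val_inj: F => F; subst S' U'.
by exists n, T, S, U, W, b, c, d.
Qed.

Lemma Vrep3 (x y z : Vbr) :
  exists n (T S U W : ntree n) (b c d : braid n),
  [/\ x = Vclass T b S, y = Vclass S c U & z = Vclass U d W].
Proof.
have [n [S [U [W [c [d [-> ->]]]]]]] := Vrep2 y z.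
have [a xa ra] := expand_to_right (subtree_joinl (dright (repr x)) (val S)).
have [b yb lb] := @expand_to_left (diag S c U) _ (subtree_joinr (dright (repr x)) (val S)).
have [e ze le] := @expand_to_left (diag U d W) _ (expand_right yb).
have [m [T' [S' [U' [W' [b' [c' [d' [aE bE eE]]]]]]]]] :=
  composableP2 (etrans ra (esym lb)) (esym le).
exists m, T', S', U', W', b', c', d'.
by rewrite -[x]reprK /Vclass (Vexpand xa) (Vexpand yb) (Vexpand ze) aE bE eE.
Qed.

Lemma VinvE n (T S : ntree n) (b : braid n) :
  Vinv (Vclass T b S) = Vclass S b^-1 T.
Proof.
rewrite /Vinv; have /VeqP[z /expand_inv/Vexpand -> /expand_inv/Vexpand] :=
  reprK (Vclass T b S).
by [].
Qed.

Lemma VoneE n (T : ntree n) : Vclass T 1 T = Vone.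
Proof.
suff E : forall x y, expand x y ->
    (exists n (T : ntree n), x = diag T 1 T) -> exists n (T : ntree n), y = diag T 1 T.
  have [y xy ry] := @expand_to_right (diag (leaf_tree) 1 leaf_tree) (val T) isT.
  rewrite /Vone /Vclass (Vexpand xy).
  have [|m [T' yE]] := E _ _ xy; first by exists 1%N, leaf_tree.
  move: ry; rewrite yE /dright /= => T'T.
  have mn : m = n := ntree_size T'T.
  by subst m; move/val_inj: T'T => ->.
move=> x y; elim=> {x y} [x|x x' y xx' _ IH] [m [T' xE]]; first by exists m, T'.
apply: IH.
move: xx'; rewrite xE => /expansionP[k ->].
exists m.+1, (nattach T' k).
by rewrite /dexp rho1 perm1 kappa1.
Qed.

Lemma VmulA : associative Vmul.
Proof.
move=> x y z; have [n [T [S [U [W [b [c [d [-> -> ->]]]]]]]]] := Vrep3 x y z.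
by rewrite !VmulE mulgA.
Qed.

Lemma Vrep (x : Vbr) : exists n (T S : ntree n) (b : braid n), x = Vclass T b S.
Proof. by have [n [T [S [U [b [c [xE _]]]]]]] := Vrep2 x x; exists n, T, S, b. Qed.

Lemma Vmul1 : left_id Vone Vmul.
Proof.
by move=> x; have [n [T [S [b ->]]]] := Vrep x; rewrite -(VoneE T) VmulE mul1g.
Qed.

Lemma Vmulr1 : right_id Vone Vmul.
Proof.
by move=> x; have [n [T [S [b ->]]]] := Vrep x; rewrite -(VoneE S) VmulE mulg1.
Qed.

Lemma VmulV : left_inverse Vone Vinv Vmul.
Proof.
move=> x; have [n [T [S [b ->]]]] := Vrep x.
by rewrite VinvE VmulE mulVg VoneE.
Qed.

Lemma VmulVr : right_inverse Vone Vinv Vmul.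
Proof.
move=> x; have [n [T [S [b ->]]]] := Vrep x.
by rewrite VinvE VmulE mulgV VoneE.
Qed.

HB.instance Definition _ := isGroup.Build Vbr VmulA Vmul1 Vmulr1 VmulV VmulVr.

Section Subgroups.
Variable G : groupType.

Definition is_subgroup (H : set G) : Prop := group_closed [in H].

Definition is_normal_subgroup (H N : set G) : Prop :=
  [/\ is_subgroup N, N `<=` H & forall h x, H h -> N x -> N (x ^ h)].

Definition commutator_subgroup (H K : set G) : set G :=
  smallest is_subgroup [set [~ h, k] | h in H & k in K].

Lemma is_subgroupP (H : set G) :
  is_subgroup H <-> H 1 /\ forall x y, H x -> H y -> H (x * y^-1).
Proof.
have E x : x \in [in H] <-> H x by split=> [|Hx]; [move/set_mem|exact/mem_set].
split=> -[H1 HM]; split=> [|x y]; try exact/E.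
- by move=> /E Hx /E Hy; apply/E/HM.
- by move=> /E Hx /E Hy; apply/E/HM.
Qed.
End Subgroups.

Definition pure n (b : braid n) : Prop := rho b = 1.

Definition Fbr : set Vbr :=
  [set x | exists n (T S : ntree n) (p : braid n), pure p /\ x = Vclass T p S].

Definition Pbr : set Vbr :=
  [set x | exists n (T : ntree n) (p : braid n), pure p /\ x = Vclass T p T].

Lemma pure_kappa n (k : 'I_n) (b : braid n) : pure b -> pure (kappa k b).
Proof.
rewrite /pure => b1; have fix_lift l : rho (kappa k b) (lift (wid k) l) = lift (wid k) l.
  by rewrite rho_kappa b1 !perm1.
apply/permP => m; rewrite perm1.
have [l ->|->] := unliftP (wid k) m; first exact: fix_lift.
have [l E|//] := unliftP (wid k) (rho (kappa k b) (wid k)).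
by move: (E); rewrite -fix_lift => /perm_inj/eqP; rewrite (negbTE (neq_lift _ _)).
Qed.

Definition dpure (x : diagram) : Prop := pure (tagged x).1.2.

Lemma expand_pure x y : expand x y -> dpure x -> dpure y.
Proof.
elim=> {x y} [//|x y z xy _ IH] px; apply: IH; case: xy px => n T b S k.
exact: pure_kappa.
Qed.

Lemma expand_diagonal x y : expand x y -> dpure x -> dleft x = dright x ->
  dleft y = dright y.
Proof.
elim=> {x y} [//|x y z xy _ IH] px e; apply: IH.
  exact: (expand_pure (expand1 xy)).
case: xy px e => n T b S k; rewrite /dpure /pure /dleft /dright /= => b1 ->.
by rewrite b1 perm1.
Qed.

Lemma Fbr_subgroup : is_subgroup Fbr.
Proof.
apply/is_subgroupP; split=> [|x y].
  by exists 1%N, leaf_tree, leaf_tree, 1; split=> //; exact: rho1.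
move=> -[n [T [S [p [p1 ->]]]]] [m [T' [S' [q [q1 ->]]]]].
rewrite [_^-1]VinvE.
have [a xa ra] := @expand_to_right (diag T p S) _ (subtree_joinl (val S) (val S')).
have [b yb lb] := @expand_to_left (diag S' q^-1 T') _ (subtree_joinr (val S) (val S')).
have pa := expand_pure xa p1.
have pb : dpure b by apply: (expand_pure yb); rewrite /dpure /pure /= rhoV q1 invg1.
have [z c] := composableP (etrans ra (esym lb)).
rewrite /Vclass (Vexpand xa) (Vexpand yb).
rewrite [_ * _](Vmul_composable c).
case: c pa pb {xa yb ra lb} => k A B C f g; rewrite /dpure /pure /= => f1 g1.
by exists k, A, C, (f * g); rewrite /pure rhoM f1 g1 mulg1.
Qed.

Lemma Pbr_subgroup : is_subgroup Pbr.
Proof.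
apply/is_subgroupP; split=> [|x y].
  by exists 1%N, leaf_tree, 1; split=> //; exact: rho1.
move=> -[n [T [p [p1 ->]]]] [m [T' [q [q1 ->]]]].
rewrite [_^-1]VinvE.
have [a xa ra] := @expand_to_right (diag T p T) _ (subtree_joinl (val T) (val T')).
have [b yb lb] := @expand_to_left (diag T' q^-1 T') _ (subtree_joinr (val T) (val T')).
have q1' : rho q^-1 = 1 by rewrite rhoV q1 invg1.
have pa := expand_pure xa p1; have pb := expand_pure yb q1'.
have da := expand_diagonal xa p1 erefl; have db := expand_diagonal yb q1' erefl.
have [z c] := composableP (etrans ra (esym lb)).
rewrite /Vclass (Vexpand xa) (Vexpand yb).
rewrite [_ * _](Vmul_composable c).
case: c pa pb da db {xa yb ra lb} => k A B C f g.
rewrite /dpure /pure /dleft /dright /= => f1 g1 /val_inj AB /val_inj BC.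
subst; by exists k, C, (f * g); rewrite /pure rhoM f1 g1 mulg1.
Qed.

Lemma Pbr_sub_Fbr : Pbr `<=` Fbr.
Proof. by move=> x [n [T [p [p1 ->]]]]; exists n, T, T, p. Qed.

(* Main.v *)
From HB Require Import structures.
From mathcomp Require Import all_boot fingroup perm generic_quotient zify.
From mathcomp Require Import boolp classical_sets.
Require Import Defs.

(** Let [Q] be the quotient of [Fbr] by [N]. If [N] is not contained in [Pbr],
    we show that [Q] is abelian. Elements of [Fbr] are products of a diagonal
    element [(T, p, T)] and an element [(T, 1, S)] of Thompson's group F, so
    three facts suffice.

    F has abelian image. For every tree [T], the element [(T, 1, S)] with [S] a
    right comb is a positive word in elements [x_0, x_1, ...] which satisfy
    [x_j x_i = x_i x_(j+1)] for [i < j], and F becomes abelian as soon as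
    [x_1 = x_2] ([x_comm]). Now take [(T, p, S)] in [N] with [T <> S]. A pure
    braid lets whatever happens at one leaf slide along the strand ([slide]), so
    conjugation by [(T, p, S)] carries an element of F supported at a leaf of
    [T] to the same element at the leaf of [S] with the same number. Comparing
    the words of [T] and [S] at the first leaf where the trees differ
    ([rmono_branch]) makes such a local element equal in [Q] to a translate of
    itself with which the local copy of F commutes; hence local copies of F
    become abelian, and this is the relation [x_1 = x_2] ([swing_period],
    [kernel_gx]).

    F commutes with the diagonal elements. By sliding again, [(T, p, T)]
    commutes with the elements of F supported at the first or at the last leaf
    of [T], and these already generate the abelianization of F
    ([diagonal_gx]). Hence the image of [(T, p, T)] depends on [p] only, and the
    resulting homomorphisms [phi_n] on the pure braid groups are invariant under
    cloning.

    Such a family of homomorphisms has abelian image ([phi_comm]). The pure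
    braid group is generated by the elements A(i, j) in which the strand at [j]
    goes once around the strand at [i] ([pure_generated]). Cloning an endpoint
    splits A(i, j) into a product of two generators and cloning another strand
    only shifts indices. Comparing these relations for at least three strands,
    phi kills every A(i, j) except the adjacent ones, which share one image, and
    the outermost ones A(0, n-1), which share another; the two images commute
    because A(0, 3) and A(1, 2) do. *)

Set Implicit Arguments.
Unset Strict Implicit.
Unset Printing Implicit Defensive.

Local Open Scope classical_set_scope.
Local Open Scope quotient_scope.
Local Open Scope group_scope.

(** * Quotient of a group by a normal subgroup *)

Section NormalQuotient.
Variables (G : groupType) (H N : set G).
Hypotheses (subH : is_subgroup H) (nN : is_normal_subgroup H N).

Let H1 : H 1. Proof. by case/is_subgroupP: subH. Qed.
Let HV x : H x -> H x^-1.
Proof. by case/is_subgroupP: subH => h1 hd /(hd _ _ h1); rewrite mul1g. Qed.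
Let HM x y : H x -> H y -> H (x * y).
Proof.
by case/is_subgroupP: (subH) => _ hd hx /HV hy; rewrite -[y]invgK; exact: hd.
Qed.
Let N1 : N 1. Proof. by case: nN => /is_subgroupP[]. Qed.
Let ND x y : N x -> N y -> N (x * y^-1).
Proof. by case: nN => /is_subgroupP[_ h] _ _; exact: h. Qed.
Let NV x : N x -> N x^-1.
Proof. by move=> /(ND N1); rewrite mul1g. Qed.
Let NM x y : N x -> N y -> N (x * y).
Proof. by move=> nx /NV ny; rewrite -[y]invgK; exact: ND. Qed.
Let NJ x h : H h -> N x -> N (h * x * h^-1).
Proof.
move=> /HV hh nx; case: nN => _ _ /(_ _ _ hh nx).
by rewrite /conjg invgK mulgA.
Qed.

(** Sending everything outside [H] to [1] lets the quotient of [H] by [N] be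
    carried by a quotient of the ambient type, without a type for [H]. *)
Definition clamp x := if `[< H x >] then x else 1.

Let clampH x : H (clamp x).
Proof. by rewrite /clamp; case: asboolP. Qed.
Let clampE x : H x -> clamp x = x.
Proof. by rewrite /clamp; case: asboolP. Qed.

Definition coset_rel : rel G := fun x y => `[< N (clamp x * (clamp y)^-1) >].

Lemma coset_rel_refl : reflexive coset_rel.
Proof. by move=> x; apply/asboolP; rewrite mulgV. Qed.

Lemma coset_rel_sym : symmetric coset_rel.
Proof.
by move=> x y; apply/asboolP/asboolP => /NV; rewrite invMg invgK.
Qed.

Lemma coset_rel_trans : transitive coset_rel.
Proof.
move=> y x z /asboolP xy /asboolP yz; apply/asboolP.
by have := NM xy yz; rewrite mulgA mulgVK.
Qed.

Canonical coset_equiv :=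
  EquivRel coset_rel coset_rel_refl coset_rel_sym coset_rel_trans.

Definition quotient := {eq_quot coset_rel}.
HB.instance Definition _ := Choice.on quotient.
HB.instance Definition _ := EqQuotient.on quotient.

Lemma quotient_eqP x y :
  \pi_quotient x = \pi_quotient y <-> N (clamp x * (clamp y)^-1).
Proof. by split=> [/eqP|h]; [|apply/eqP]; rewrite eqmodE; [move/asboolP|apply/asboolP]. Qed.

Definition qmul (a b : quotient) := \pi_quotient (clamp (repr a) * clamp (repr b)).
Definition qinv (a : quotient) := \pi_quotient (clamp (repr a))^-1.

Lemma qmulE x y : qmul (\pi x) (\pi y) = \pi_quotient (clamp x * clamp y).
Proof.
apply/quotient_eqP; rewrite !(clampE (HM (clampH _) (clampH _))) invMg.
have /quotient_eqP nx := reprK (\pi_quotient x).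
have /quotient_eqP := reprK (\pi_quotient y).
set x' := repr _ in nx *; set y' := repr _ => /(NJ (clampH x')) ny.
by have := NM ny nx; rewrite !mulgA mulgVK.
Qed.

Lemma qinvE x : qinv (\pi x) = \pi_quotient (clamp x)^-1.
Proof.
apply/quotient_eqP; rewrite !(clampE (HV (clampH _))) invgK.
have /quotient_eqP := reprK (\pi_quotient x); set x' := repr _.
move=> /NV/(NJ (HV (clampH x'))).
by rewrite invMg !invgK !mulgA mulgVK.
Qed.

Lemma clamp_pi x : \pi_quotient (clamp x) = \pi_quotient x.
Proof. by apply/quotient_eqP; rewrite (clampE (clampH x)) mulgV. Qed.

Lemma qmulA : associative qmul.
Proof.
move=> a b c; rewrite -[a]reprK -[b]reprK -[c]reprK !qmulE.
by rewrite !(clampE (HM (clampH _) (clampH _))) mulgA.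
Qed.

Lemma qmul1 : left_id (\pi_quotient 1) qmul.
Proof. by move=> a; rewrite -[a]reprK qmulE (clampE H1) mul1g clamp_pi. Qed.

Lemma qmulr1 : right_id (\pi_quotient 1) qmul.
Proof. by move=> a; rewrite -[a]reprK qmulE (clampE H1) mulg1 clamp_pi. Qed.

Lemma qmulVg : left_inverse (\pi_quotient 1) qinv qmul.
Proof.
by move=> a; rewrite -[a]reprK qinvE qmulE (clampE (HV (clampH _))) mulVg.
Qed.

Lemma qmulgV : right_inverse (\pi_quotient 1) qinv qmul.
Proof.
by move=> a; rewrite -[a]reprK qinvE qmulE (clampE (HV (clampH _))) mulgV.
Qed.

HB.instance Definition _ := isGroup.Build quotient
  qmulA qmul1 qmulr1 qmulVg qmulgV.

Lemma normal_quotient : exists (Q : groupType) (f : G -> Q),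
  (forall x y, H x -> H y -> f (x * y) = f x * f y) /\
  (forall x, H x -> f x = 1 <-> N x).
Proof.
exists quotient, (\pi_quotient); split=> [x y hx hy|x hx].
  by rewrite -[RHS]/(qmul _ _) qmulE !clampE.
by rewrite -[1]/(\pi_quotient 1) quotient_eqP (clampE hx) (clampE H1) invg1 mulg1.
Qed.
End NormalQuotient.

(** * Cloning, and classes of pure diagrams *)

Lemma rho_kappa_wid n (k : 'I_n) (b : braid n) :
  rho (kappa k b) (wid k) = wid (rho b k).
Proof.
have [l E|//] := unliftP (wid (rho b k)) (rho (kappa k b) (wid k)).
have : rho (kappa k b) (wid k) = rho (kappa k b) (lift (wid k) ((rho b)^-1 l)).
  by rewrite rho_kappa permKV.
by move/perm_inj/eqP; rewrite (negbTE (neq_lift _ _)).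
Qed.

Lemma kcl_diag n k i e : kcl n k.+1 k i e = kcl n k k i e.
Proof.
rewrite /kcl /cl /tp; have [ki|ki|ki] := ltngtP k i.
- by do ![case: ifP; try lia].
- have [ki'|ki'|ki'] := ltngtP k i.+1; [lia| |].
    by do ![case: ifP; try lia].
  by subst k; do ![case: ifP; try lia]; rewrite !mulgA.
- by subst k; do ![case: ifP; try lia]; rewrite !mulgA.
Qed.

(** Tripling a strand does not depend on which of its two copies is doubled
    again. Only the crossings with that strand matter, and there both orders
    give the crossing of one strand with three parallel ones. *)
Lemma kappa_coassoc n (k : 'I_n) (b : braid n) :
  kappa (lift (wid k) k) (kappa k b) = kappa (wid k) (kappa k b).
Proof.
elim/braid_ind: b => [|[i e] b IH]; first by rewrite !kappa1.
rewrite !kappaM IH rho_kappa rho_kappa_wid; congr (_ * _).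
rewrite -!genE !kappa_gen // !kappa_cl //=.
by rewrite {1}/bump leqnn add1n; exact: kcl_diag.
Qed.

(** Diagrams over bare trees: the number of leaves is a side condition instead
    of an index, so that trees can be grown without casts. Outside the intended
    domain the value is [1]. *)
Definition dclass n (T : tree) (b : braid n) (S : tree) : Vbr :=
  if insub T is Some T' then
    if insub S is Some S' then @Vclass n T' b S' else 1
  else 1.

Lemma dclassE n (T S : ntree n) b : dclass (val T) b (val S) = Vclass T b S.
Proof. by rewrite /dclass !valK. Qed.

Section Diagrams.
Variable n : nat.
Implicit Types T S U : tree.

Lemma dclass_mul T S U (b c : braid n) :
  leaves T = n -> leaves S = n -> leaves U = n ->
  dclass T b S * dclass S c U = dclass T (b * c) U.
Proof.
move=> /eqP hT /eqP hS /eqP hU.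
pose T' : ntree n := exist _ T hT; pose S' : ntree n := exist _ S hS.
pose U' : ntree n := exist _ U hU.
by rewrite (dclassE T' S') (dclassE S' U') (dclassE T' U'); exact: VmulE.
Qed.

Lemma dclass_expand T S (b : braid n) (k : 'I_n) :
  leaves T = n -> leaves S = n -> pure b ->
  dclass T b S = dclass (attach T k) (kappa k b) (attach S k).
Proof.
move=> /eqP hT /eqP hS pb.
pose T' : ntree n := exist _ T hT; pose S' : ntree n := exist _ S hS.
rewrite (dclassE T' S') (dclassE (nattach T' k) (nattach S' k)).
have := Vexpand (expand1 (Expansion T' b S' k)).
by rewrite /Vclass => ->; rewrite pb perm1.
Qed.

Lemma dclass_Fbr T S (b : braid n) :
  leaves T = n -> leaves S = n -> pure b -> Fbr (dclass T b S).
Proof.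
move=> /eqP hT /eqP hS pb; exists n, (exist _ T hT), (exist _ S hS), b.
by split=> //; rewrite -dclassE.
Qed.

Lemma FbrP x : Fbr x ->
  exists m T S (b : braid m), [/\ leaves T = m, leaves S = m, pure b & x = dclass T b S].
Proof.
move=> [m [T [S [b [pb ->]]]]]; exists m, (val T), (val S), b.
by split=> //; [exact/eqP/(valP T)|exact/eqP/(valP S)|rewrite dclassE].
Qed.

Lemma dclass_sub_Pbr T (b : braid n) : leaves T = n -> pure b -> Pbr (dclass T b T).
Proof.
move=> /eqP hT pb; exists n, (exist _ T hT), b.
by split=> //; rewrite -dclassE.
Qed.
End Diagrams.

Lemma pure1 n : pure (1 : braid n). Proof. exact: rho1. Qed.
Lemma pureM n (b c : braid n) : pure b -> pure c -> pure (b * c).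
Proof. by rewrite /pure rhoM => -> ->; rewrite mulg1. Qed.
Lemma pureV n (b : braid n) : pure b -> pure b^-1.
Proof. by rewrite /pure rhoV => ->; rewrite invg1. Qed.

Definition Felt (T S : tree) : Vbr := dclass T (1 : braid (leaves T)) S.

Lemma FeltE n T S : leaves T = n -> Felt T S = dclass T (1 : braid n) S.
Proof. by move=> <-. Qed.

Lemma Felt_Fbr T S : leaves T = leaves S -> Fbr (Felt T S).
Proof. by move=> h; apply: dclass_Fbr => //; exact: pure1. Qed.

Lemma Felt_mul T S U : leaves T = leaves S -> leaves S = leaves U ->
  Felt T S * Felt S U = Felt T U.
Proof.
move=> hT hS; rewrite (FeltE S hT) (FeltE U (erefl (leaves S))) (FeltE U hT).
by rewrite dclass_mul // mulg1.
Qed.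

Lemma Felt_attach T S k : leaves T = leaves S -> k < leaves T ->
  Felt (attach T k) (attach S k) = Felt T S.
Proof.
move=> hT kT; rewrite (FeltE _ (leaves_attach T k)) /Felt.
rewrite (dclass_expand (Ordinal kT)) //; last exact: pure1.
by rewrite kappa1.
Qed.

(** Attaching carets at leaf [l] and then at leaf [l] or [l+1] triples the same
    strand of [p], hence by [kappa_coassoc] yields the same braid; the element
    of F at leaf [l] therefore passes through [(T, p, S)]. *)
Lemma slide n (T S : tree) (p : braid n) (l : nat) :
  leaves T = n -> leaves S = n -> pure p -> l < n ->
  Felt (attach (attach T l) l) (attach (attach T l) l.+1) * dclass T p S =
  dclass T p S * Felt (attach (attach S l) l) (attach (attach S l) l.+1).
Proof.
move=> hT hS pp ln; pose k := Ordinal ln; pose q := kappa k p.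
have pq : pure q := pure_kappa k pp.
have [hT1 hS1] : leaves (attach T l) = n.+1 /\ leaves (attach S l) = n.+1.
  by rewrite !leaves_attach hT hS.
have E0 := dclass_expand k hT hS pp; rewrite -/q /= in E0.
have El := dclass_expand (wid k) hT1 hS1 pq; rewrite /= in El.
have Er := dclass_expand (lift (wid k) k) hT1 hS1 pq.
rewrite kappa_coassoc /= /bump leqnn add1n in Er.
have L U m : leaves U = n.+1 -> leaves (attach U m) = n.+2.
  by move=> hU; rewrite leaves_attach hU.
rewrite !(FeltE _ (L _ l hT1)) !(FeltE _ (L _ l hS1)) E0 {1}Er El.
by rewrite !dclass_mul ?(L _ _ hT1) ?(L _ _ hS1) // mul1g mulg1.
Qed.

(** * The relations of Thompson's group F *)

Section ThompsonRelations.
Variables (Q : groupType) (x : nat -> Q).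
Hypothesis xx : forall i j, i < j -> x j * x i = x i * x j.+1.

(** The letter [x i] stands for attaching a caret at leaf [i]; [mono o T] spells
    the growth of [T] at leaf [o], provided that [o] is not the last leaf. *)
Fixpoint mono (o : nat) (T : tree) : Q :=
  if T is Node L R then x o * mono o L * mono (o + leaves L) R else 1.

(** The growth of [T] when its root sits at the last leaf, whose number is [o].
    Carets attached at a last leaf contribute no letter, since they only enlarge
    the right comb to which trees are compared. *)
Fixpoint rmono (o : nat) (T : tree) : Q :=
  if T is Node L R then mono o L * rmono (o + leaves L) R else 1.

Lemma mono_shift i o T : i < o -> mono o T * x i = x i * mono o.+1 T.
Proof.
elim: T o => [|L IHL R IHR] o io /=; first by rewrite mul1g mulg1.
rewrite -mulgA IHR; last by lia.
by rewrite mulgA -(mulgA (x o)) IHL // !mulgA xx // addSn.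
Qed.

Lemma mono_attach o T k : k < leaves T ->
  mono o (attach T k) = mono o T * x (o + k).
Proof.
elim: T o k => [|L IHL R IHR] o k /=.
  by case: k => // _; rewrite addn0 mul1g !mulg1.
case: ifP => kL kR /=; last first.
  rewrite IHR; last by lia.
  by rewrite !mulgA -addnA subnKC // leqNgt kL.
rewrite IHL // leaves_attach addnS -!mulgA; do 2 congr (_ * _).
by rewrite mono_shift //; lia.
Qed.

Lemma rmono_shift i o T : i < o -> rmono o T * x i = x i * rmono o.+1 T.
Proof.
elim: T o => [|L IHL R IHR] o io /=; first by rewrite mul1g mulg1.
rewrite -mulgA IHR; last by lia.
by rewrite mulgA mono_shift // !mulgA addSn.
Qed.

Lemma rmono_attach o T k : k.+1 < leaves T ->
  rmono o (attach T k) = rmono o T * x (o + k).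
Proof.
elim: T o k => [|L IHL R IHR] o k //= kT; case: ifP => kL /=; last first.
  rewrite IHR; last by lia.
  by rewrite !mulgA -addnA subnKC // leqNgt kL.
rewrite mono_attach // leaves_attach addnS -!mulgA; congr (_ * _).
by rewrite rmono_shift //; lia.
Qed.

Lemma rmono_attach_last o T k : leaves T = k.+1 ->
  rmono o (attach T k) = rmono o T.
Proof.
elim: T o k => [|L IHL R IHR] o k //= kT; first by rewrite mulg1.
have := leaves_gt0 R; case: ifP => kL /=; first by lia.
by rewrite IHR; last lia.
Qed.

Inductive word_above (k : nat) : Q -> Prop :=
| WordAbove1 : word_above k 1
| WordAboveM i y : k < i -> word_above k y -> word_above k (x i * y).

Lemma word_aboveM k y y' : word_above k y -> word_above k y' -> word_above k (y * y').
Proof.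
by move=> ky ky'; elim: ky => [|i {}y ki _ IH]; rewrite ?mul1g // -mulgA; constructor.
Qed.

Lemma word_above1 k i : k < i -> word_above k (x i).
Proof. by move=> ki; rewrite -[x i]mulg1; apply: WordAboveM ki (WordAbove1 _). Qed.

Lemma word_above_mono k o T : k < o -> word_above k (mono o T).
Proof.
elim: T o => [|L IHL R IHR] o ko /=; first by constructor.
apply: word_aboveM; last by apply: IHR; lia.
by apply: word_aboveM; [exact: word_above1|exact: IHL].
Qed.

Lemma word_above_rmono k o T : k < o -> word_above k (rmono o T).
Proof.
elim: T o => [|L IHL R IHR] o ko /=; first by constructor.
by apply: word_aboveM; [exact: word_above_mono|apply: IHR; lia].
Qed.

Lemma word_above_shift k i y : i <= k -> word_above k y ->
  exists2 y', word_above k.+1 y' & y * x i = x i * y'.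
Proof.
move=> ik; elim=> [|j {}y kj _ [y' ky' E]].
  by exists 1; [constructor|rewrite mul1g mulg1].
exists (x j.+1 * y'); first by constructor.
by rewrite -mulgA E !mulgA xx //; lia.
Qed.

Lemma mono_left o T : T <> Leaf ->
  exists j y, word_above o y /\ mono o T = x o ^+ j.+1 * y.
Proof.
elim: T => [//|L IHL R _] _ /=; have wR : word_above o (mono (o + leaves L) R).
  by apply: word_above_mono; have := leaves_gt0 L; lia.
have [eL|/IHL[j [y [wy ->]]]] := pselect (L = Leaf).
  by subst L; exists 0, (mono (o + leaves Leaf) R); rewrite expg1 mulg1.
exists j.+1, (y * mono (o + leaves L) R); split; first exact: word_aboveM.
by rewrite !mulgA -expgS.
Qed.

(** The two words part after a common prefix [g]: the second one continues with
    at least one letter [x k] where the first one has none, and all that remains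
    happens strictly to the right of [k]. *)
Definition branch k (u v : Q) : Prop := exists g j y y',
  [/\ word_above k y, word_above k y', u = g * y & v = g * x k ^+ j.+1 * y'].

Lemma branch_mulr k u v w w' : branch k u v -> word_above k w -> word_above k w' ->
  branch k (u * w) (v * w').
Proof.
move=> [g [j [y [y' [ky ky' -> ->]]]]] kw kw'.
by exists g, j, (y * w), (y' * w'); split; rewrite -?mulgA //; exact: word_aboveM.
Qed.

Lemma branch_mull k u v w : branch k u v -> branch k (w * u) (w * v).
Proof.
move=> [g [j [y [y' [ky ky' -> ->]]]]].
by exists (w * g), j, y, y'; split; rewrite ?mulgA.
Qed.

(** Take for [k] the first leaf at which the two trees differ: one of them has a
    leaf there, the other a larger subtree, whose leftmost branch gives the
    letters [x k]. *)
Lemma mono_branch o T S : T <> S -> exists k,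
  [/\ o <= k, k < o + leaves T, k < o + leaves S &
    branch k (mono o T) (mono o S) \/ branch k (mono o S) (mono o T)].
Proof.
elim: T S o => [|L IHL R IHR] [|L' R'] o //= TS.
- have [|j [y [wy /= ->]]] := @mono_left o (Node L' R'); first by [].
  exists o; split; rewrite ?addn1 //; first by have := leaves_gt0 L'; lia.
  by left; exists 1, j, 1, y; rewrite !mul1g; split=> //; constructor.
- have [|j [y [wy /= ->]]] := @mono_left o (Node L R); first by [].
  exists o; split; rewrite ?addn1 //; first by have := leaves_gt0 L; lia.
  by right; exists 1, j, 1, y; rewrite !mul1g; split=> //; constructor.
have [eL|neL] := pselect (L = L').
  have neR : R <> R' by move=> eR; apply: TS; rewrite eL eR.
  subst L'; have [k [ok kT kS B]] := IHR _ (o + leaves L) neR.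
  exists k; split; try lia.
  by case: B => /(branch_mull (x o * mono o L)); [left|right].
have [k [ok kT kS B]] := IHL _ o neL; exists k; split; try lia.
have wR : word_above k (mono (o + leaves L) R) by apply: word_above_mono.
have wR' : word_above k (mono (o + leaves L') R') by apply: word_above_mono.
by case: B => /(branch_mull (x o)) B; [left|right]; apply: branch_mulr.
Qed.

Lemma rmono_branch o T S : leaves T = leaves S -> T <> S -> exists k,
  [/\ o <= k, k.+1 < o + leaves T &
    branch k (rmono o T) (rmono o S) \/ branch k (rmono o S) (rmono o T)].
Proof.
elim: T S o => [|L IHL R IHR] [|L' R'] o //= lTS TS.
- by have := leaves_gt0 L'; have := leaves_gt0 R'; lia.
- by have := leaves_gt0 L; have := leaves_gt0 R; lia.
have [eL|neL] := pselect (L = L').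
  have neR : R <> R' by move=> eR; apply: TS; rewrite eL eR.
  subst L'; have [|k [ok kT B]] := IHR _ (o + leaves L) _ neR; first by lia.
  exists k; split; try lia.
  by case: B => /(branch_mull (mono o L)); [left|right].
have [k [ok kT kS B]] := mono_branch o neL.
exists k; split; first by [].
  by have := leaves_gt0 R; lia.
have wR : word_above k (rmono (o + leaves L) R) by apply: word_above_rmono.
have wR' : word_above k (rmono (o + leaves L') R') by apply: word_above_rmono.
by case: B => B; [left|right]; apply: branch_mulr.
Qed.

(** The rotation of a three-leaved tree grown at leaf [i]. *)
Definition swing i := x i * x i * (x i.+1)^-1 * (x i)^-1.

Lemma conj_x i j : i < j -> x j ^ x i = x j.+1.
Proof. by move=> ij; rewrite /conjg xx // mulKg. Qed.

Lemma conj_swing k i : k < i -> swing i ^ x k = swing i.+1.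
Proof. by move=> ki; rewrite /swing !conjMg !conjVg !conj_x // ltnW. Qed.

Lemma conj_swing_expg k i j : k < i -> swing i ^ (x k ^+ j) = swing (i + j).
Proof.
move=> ki; elim: j => [|j IH]; first by rewrite conjg1 addn0.
by rewrite expgSr conjgM IH conj_swing ?addnS //; lia.
Qed.

(** Two words for trees grown at leaf [l] with equally many leaves translate
    everything to the right of [l] by the same amount, so [swing (l + j.+1)]
    commutes with their quotient. If it equals [swing l], then [swing l]
    commutes with the rotation one step deeper at the same leaf; written out,
    this commutation is the conclusion. *)
Lemma swing_period l j : swing (l + j.+1) = swing l -> x l.+1 = x l.+2.
Proof.
move=> per.
have E : swing l ^ (x l * x l.+1 * x l.+1) = swing l ^ (x l * x l.+1 * x l.+2).
  by rewrite -per !conjgM !conj_swing //; lia.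
have Ec : swing l ^ (x l * x l.+1) = (x l.+1)^-1 * x l.
  by rewrite /swing /conjg invMg !mulgA !mulgVK.
move: E; rewrite conjgM Ec conjgM Ec /conjg.
have: x l.+1 * x l = x l * x l.+2 by exact: xx.
have: x l.+2 * x l = x l * x l.+3 by apply: xx.
have: x l.+2 * x l.+1 = x l.+1 * x l.+3 by exact: xx.
set a := x l.+1; set b := x l.+2; set c := x l.+3 => ba bl al.
rewrite -(mulgA _ (x l) b) -al mulKg => E.
apply: (mulgI b); rewrite ba.
apply: (mulgI (x l)); rewrite !mulgA -!al -(mulgA a) -al -(mulgA _ a c) -ba.
have {}E : x l * a = a * a * b^-1 * x l.
  by rewrite -!mulgA -E !mulgA mulgK mulgV mul1g.
by rewrite ba mulgA E -!mulgA -bl mulKg.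
Qed.

(** Letters to the right of [i] commute with [swing i]: both three-leaved trees
    shift them by two. *)
Lemma swing_commute i y : word_above i y -> commute (swing i) y.
Proof.
elim=> [|j {}y ij _ IH]; first exact: commute1.
apply: commuteM IH.
have E : x j ^ (x i * x i) = x j ^ (x i * x i.+1).
  by rewrite !conjgM !conj_x //; lia.
have -> : swing i = x i * x i * (x i * x i.+1)^-1 by rewrite /swing invMg mulgA.
apply: commute_sym.
by rewrite /commute (conjgC (x j)) (conjgM _ (x i * x i)) E conjgK.
Qed.

(** Everything strictly to the right of [k] commutes with the local element, so
    the hypothesis reduces to invariance of [swing k.+1] under a positive power
    of [x k], which translates it; then [swing_period] applies, and conjugation
    by [x 0] moves the resulting relation down to index [1]. *)
Lemma branch_const k u v : branch k u v ->
  u * x k * swing k.+1 * (u * x k)^-1 = v * x k * swing k.+1 * (v * x k)^-1 ->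
  x 1 = x 2.
Proof.
move=> [g [j [y [y' [ky ky' -> ->]]]]].
have [y1 ky1 E1] := word_above_shift (leqnn k) ky.
have [y2 ky2 E2] := word_above_shift (leqnn k) ky'.
have [s sE] : exists s, s = swing k.+1 by eexists.
have drop w z : word_above k.+1 z -> w * z * s * (w * z)^-1 = w * s * w^-1.
  by rewrite sE invMg => /swing_commute C; rewrite -(mulgA w) -C !mulgA mulgK.
rewrite -sE -(mulgA g) E1 -(mulgA _ y') E2 !mulgA (drop _ y1) // (drop _ y2) // => E.
have P : swing (k.+1 + j.+1) = swing k.+1.
  rewrite -(@conj_swing_expg k) // -sE /conjg.
  apply: (mulgI (x k ^+ j.+1)); rewrite mulKVg.
  apply: (mulIg (x k ^+ j.+1)^-1); rewrite mulgK.
  apply: (mulgI (x k)); apply: (mulIg (x k)^-1).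
  apply: (mulgI g); apply: (mulIg g^-1).
  by move: E; rewrite -(mulgA g (_ ^+ _)) -expgSr expgS !invMg !mulgA => ->.
have := swing_period P.
have conj_iter i : 0 < i -> x i ^ (x 0 ^+ k.+1) = x (i + k.+1).
  move=> i0; elim: k.+1 => [|m IH]; first by rewrite conjg1 addn0.
  by rewrite expgSr conjgM IH conj_x ?addnS // addn_gt0 i0.
by rewrite -(conj_iter 1%N) // -(conj_iter 2%N) // => /conjg_inj.
Qed.

Hypothesis x12 : x 1 = x 2.

(** Conjugation by [x 0] translates the relation [x 1 = x 2] to all larger
    indices. *)
Lemma x_const i : x i.+1 = x 1.
Proof.
elim: i => // i IH; have := conj_x (ltn0Sn i); rewrite IH => <-.
by rewrite conj_x.
Qed.

Lemma x_comm i j : commute (x i) (x j).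
Proof.
have x01 : commute (x 0) (x 1) by rewrite /commute (xx (ltn0Sn 0)) -x12.
by case: i j => [|i] [|j]; rewrite ?x_const.
Qed.
End ThompsonRelations.

(** * The image of Fbr in a quotient *)

Fixpoint comb (n : nat) : tree := if n is m.+1 then Node Leaf (comb m) else Leaf.

Lemma leaves_comb n : leaves (comb n) = n.+1.
Proof. by elim: n => //= n ->. Qed.

Lemma attach_comb n : attach (comb n) n = comb n.+1.
Proof. by elim: n => //= n IH; rewrite subn1 IH. Qed.

Lemma tree_attach_ind (P : tree -> Prop) : P Leaf ->
  (forall T k, k < leaves T -> P T -> P (attach T k)) -> forall T, P T.
Proof.
move=> P0 PA T; have grow m S : leaves T - leaves S < m -> subtree S T -> P S -> P T.
  elim: m S => // m IH S lS ST PS; have [<-//|ne] := pselect (S = T).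
  have [k kS sk] := subtree_grow ST ne.
  apply: (IH _ _ sk); last exact: PA.
  by have := subtree_leaves sk; move: lS; rewrite leaves_attach; lia.
exact: (grow (leaves T - leaves Leaf).+1 Leaf).
Qed.

Section Image.
Variables (Q : groupType) (f : Vbr -> Q).
Hypothesis fM : forall x y, Fbr x -> Fbr y -> f (x * y) = f x * f y.

(** The comb with [k + 2] leaves is the smallest one in which leaf [k] is not
    the last; larger combs give the same element by [gxE]. *)
Definition gx k : Q := f (Felt (attach (comb k.+1) k) (comb k.+2)).

Lemma f_Felt_mul T S U : leaves T = leaves S -> leaves S = leaves U ->
  f (Felt T U) = f (Felt T S) * f (Felt S U).
Proof.
by move=> h1 h2; rewrite -fM ?Felt_mul //; apply: Felt_Fbr; rewrite // h1.
Qed.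

Lemma gxE n k : k < n -> f (Felt (attach (comb n) k) (comb n.+1)) = gx k.
Proof.
elim: n => // n IH; rewrite ltnS leq_eqVlt => /orP[/eqP <- //|kn].
rewrite -(IH kn); congr f.
rewrite -[in RHS](@Felt_attach _ _ n.+1) ?leaves_attach ?leaves_comb //.
rewrite attach_comb; congr Felt.
have := @attachC (comb n) k n; rewrite leaves_comb attach_comb /bump.
rewrite (ltnW kn) [n <= k]leqNgt kn => -> //; last exact: ltnW.
by rewrite neq_ltn kn.
Qed.

(** Position of [T] relative to the right comb with as many leaves. As F acts
    through the groupoid of trees, its elements are quotients of such values
    ([f_Felt]). *)
Definition coord T : Q := f (Felt T (comb (leaves T).-1)).

Lemma leaves_comb_pred T : leaves (comb (leaves T).-1) = leaves T.
Proof. by rewrite leaves_comb prednK // leaves_gt0. Qed.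

Lemma coord_attach T k : k.+1 < leaves T -> coord (attach T k) = coord T * gx k.
Proof.
move=> kT; have lT := leaves_comb_pred T.
rewrite /coord -(@Felt_attach T (comb (leaves T).-1) k) // 1?ltnW //.
rewrite leaves_attach /= -(@gxE (leaves T).-1); last by lia.
rewrite prednK ?leaves_gt0 //; apply: f_Felt_mul.
  by rewrite !leaves_attach lT.
by rewrite leaves_attach lT leaves_comb.
Qed.

Lemma coord_attach_last T k : leaves T = k.+1 -> coord (attach T k) = coord T.
Proof.
move=> kT; rewrite /coord leaves_attach kT [k.+2.-1]succnK -attach_comb.
by rewrite Felt_attach ?leaves_comb ?kT.
Qed.

Lemma gx_rel i j : i < j -> gx j * gx i = gx i * gx j.+1.
Proof.
move=> ij; apply: (mulgI (coord (comb j.+1))); rewrite !mulgA.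
rewrite -!coord_attach ?leaves_attach ?leaves_comb //; try lia.
have := @attachC (comb j.+1) i j; rewrite leaves_comb /bump (ltnW ij).
by rewrite [j <= i]leqNgt ij => <- //; rewrite ?neq_ltn ?ij //; lia.
Qed.

(** Attaching a caret multiplies both sides by the same letter, or by none at the
    last leaf. *)
Lemma coordE T : coord T = rmono gx 0 T.
Proof.
elim/tree_attach_ind: T => [|T k kT IH].
  have := @f_Felt_mul Leaf Leaf Leaf erefl erefl.
  by rewrite -[LHS]mulg1 => /mulgI/esym.
have [kT'|kT'] := ltnP k.+1 (leaves T).
  by rewrite coord_attach // (rmono_attach gx_rel) // IH.
have e : leaves T = k.+1 by apply/eqP; rewrite eqn_leq kT'.
by rewrite coord_attach_last // rmono_attach_last.
Qed.

Lemma f_Felt T S : leaves T = leaves S -> f (Felt T S) = coord T * (coord S)^-1.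
Proof.
move=> h; apply: (mulIg (coord S)); rewrite mulgVK /coord -h.
by rewrite -f_Felt_mul // leaves_comb_pred.
Qed.

(** The rotation supported at leaf [l] of [T]. *)
Definition turn T l := Felt (attach (attach T l) l) (attach (attach T l) l.+1).

Lemma turn_Fbr T l : Fbr (turn T l).
Proof. by apply: Felt_Fbr; rewrite !leaves_attach. Qed.

Lemma f_turn T l : l.+1 < leaves T ->
  f (turn T l) = coord T * swing gx l * (coord T)^-1.
Proof.
move=> lT; rewrite f_Felt ?leaves_attach //.
rewrite !coord_attach ?leaves_attach //; try lia.
by rewrite /swing !invMg !mulgA.
Qed.

Lemma f_turn_last T l : l.+1 = leaves T ->
  f (turn T l) = coord T * gx l * (coord T)^-1.
Proof.
move=> lT; rewrite f_Felt ?leaves_attach //.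
rewrite coord_attach ?leaves_attach ?lT // coord_attach_last //.
by rewrite !coord_attach_last ?leaves_attach ?lT.
Qed.

Lemma f_slide n T S (p : braid n) l :
  leaves T = n -> leaves S = n -> pure p -> l < n ->
  f (turn T l) * f (dclass T p S) = f (dclass T p S) * f (turn S l).
Proof.
move=> hT hS pp ln; have hx := dclass_Fbr hT hS pp.
by rewrite -!fM ?(slide hT hS pp ln) //; exact: turn_Fbr.
Qed.

Lemma f_dclass_mul n T S U (b c : braid n) :
  leaves T = n -> leaves S = n -> leaves U = n -> pure b -> pure c ->
  f (dclass T (b * c) U) = f (dclass T b S) * f (dclass S c U).
Proof.
by move=> hT hS hU pb pc; rewrite -(dclass_mul _ _ hT hS hU) fM //; exact: dclass_Fbr.
Qed.

(** An element of the kernel makes the images of the rotations at equally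
    numbered leaves of [T] and [S] equal. The leaf used is the right child of
    the first leaf at which the trees differ: the two places it occupies in the
    trees are disjoint. *)
Lemma kernel_gx n T S (p : braid n) :
  leaves T = n -> leaves S = n -> pure p -> T <> S -> f (dclass T p S) = 1 ->
  gx 1 = gx 2.
Proof.
move=> hT hS pp TS fx.
have [|k [_ kn B]] := @rmono_branch _ gx 0 T S _ TS; first by rewrite hT.
rewrite hT add0n in kn; rewrite -!coordE in B.
have kn' := ltnW kn; pose T' := attach T k; pose S' := attach S k.
have hT' : leaves T' = n.+1 by rewrite leaves_attach hT.
have hS' : leaves S' = n.+1 by rewrite leaves_attach hS.
have := dclass_expand (Ordinal kn') hT hS pp; rewrite /= => E.
have := f_slide hT' hS' (pure_kappa (Ordinal kn') pp) (kn' : k.+1 < n.+1).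
rewrite -E fx mulg1 mul1g !f_turn ?hT' ?hS' //; try lia.
rewrite !coord_attach ?hT ?hS //; try lia.
by case: B => /(branch_const gx_rel) B; [|move/esym]; exact: B.
Qed.

Hypothesis gx12 : gx 1 = gx 2.

Lemma gx_comm i j : commute (gx i) (gx j).
Proof. exact: x_comm gx_rel gx12 i j. Qed.

Lemma commute_rmono (q : Q) o T : (forall i, commute q (gx i)) ->
  commute q (rmono gx o T).
Proof.
move=> qx; have M o' S : commute q (mono gx o' S).
  elim: S o' => [|L IHL R IHR] o' /=; first exact: commute1.
  by apply: commuteM => //; apply: commuteM.
elim: T o => [|L IHL R IHR] o /=; first exact: commute1.
exact: commuteM.
Qed.

Lemma commute_Felt (q : Q) T S : leaves T = leaves S ->
  (forall i, commute q (gx i)) -> commute q (f (Felt T S)).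
Proof.
move=> h qx; rewrite f_Felt // !coordE.
by apply: commuteM; [|apply: commuteV]; exact: commute_rmono.
Qed.

Lemma gx_comm_coord i T : commute (gx i) (coord T).
Proof. by rewrite coordE; apply: commute_rmono => j; exact: gx_comm. Qed.

(** A diagonal element commutes with the rotations at the first and at the last
    leaf, whose images are [gx 0 * (gx 1)^-1] and [gx 1]. *)
Lemma diagonal_gx n T (p : braid n) i : leaves T = n -> pure p ->
  commute (f (dclass T p T)) (gx i).
Proof.
(* With one leaf only, the first and the last leaf coincide; expand once. *)
wlog n1 : n T p / 1 < n => [H hT pp|hT pp].
  have n0 : 0 < n by rewrite -hT leaves_gt0.
  rewrite (dclass_expand (Ordinal n0) hT hT pp); apply: H.
  - by [].
  - by rewrite leaves_attach hT.
  - exact: pure_kappa.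
have C l : l < n -> commute (f (dclass T p T)) (f (turn T l)).
  by move=> ln; rewrite /commute -f_slide.
have Z (z : Q) : commute z (coord T) -> coord T * z * (coord T)^-1 = z.
  by move=> <-; rewrite mulgK.
have C1 : commute (f (dclass T p T)) (gx 1).
  have := C n.-1; rewrite f_turn_last ?Z ?prednK ?hT //; try exact: gx_comm_coord; try lia.
  have -> : gx n.-1 = gx 1.
    by rewrite -(@x_const _ _ gx_rel gx12 n.-2); congr gx; lia.
  by apply; lia.
case: i => [|i]; last by rewrite (x_const gx_rel gx12).
have S0 : swing gx 0 = gx 0 * (gx 1)^-1.
  by rewrite /swing -mulgA -invMg gx_comm invMg !mulgA mulgK.
have := C 0; rewrite f_turn ?hT // Z S0.
  move/(_ (ltnW n1)) => C0; rewrite -[gx 0](mulgVK (gx 1)); exact: commuteM.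
apply/commute_sym/commuteM; first exact/commute_sym/gx_comm_coord.
exact/commuteV/commute_sym/gx_comm_coord.
Qed.

(** The choice of the comb is immaterial by [phiE]. *)
Definition phi n (p : braid n) : Q := f (dclass (comb n.-1) p (comb n.-1)).

Lemma phiE n T (p : braid n) : leaves T = n -> pure p -> f (dclass T p T) = phi p.
Proof.
move=> hT pp; pose R := comb n.-1.
have hR : leaves R = n by rewrite leaves_comb prednK // -hT leaves_gt0.
have C := @commute_Felt (phi p) T R (etrans hT (esym hR)) (fun i => diagonal_gx i hR pp).
have := f_dclass_mul hT hT hR pp (@pure1 n).
rewrite mulg1 -{1}[p]mul1g (f_dclass_mul hT hR hR (@pure1 n) pp) -/(phi p).
by rewrite -(FeltE _ hT) -C => /mulIg.
Qed.

Lemma phiM n (p q : braid n) : pure p -> pure q -> phi (p * q) = phi p * phi q.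
Proof.
case: n p q => [|n] p q pp pq; last by apply: f_dclass_mul; rewrite // leaves_comb.
have E (b : braid 0) : phi b = f 1 by rewrite /phi /dclass insubF.
have F1 : Fbr 1 by case/is_subgroupP: Fbr_subgroup.
by rewrite !E -fM // mulg1.
Qed.

Lemma phi_kappa n (k : 'I_n) (p : braid n) : pure p -> phi (kappa k p) = phi p.
Proof.
move=> pp; have hR : leaves (comb n.-1) = n.
  by rewrite leaves_comb prednK //; case: k => i; lia.
rewrite {2}/phi (dclass_expand k hR hR pp) phiE //; last exact: pure_kappa.
by rewrite leaves_attach hR.
Qed.

Lemma Fbr_image x : Fbr x -> exists n (p : braid n) T S,
  [/\ 0 < n, pure p, leaves T = leaves S, f x = phi p * f (Felt T S) &
    forall i, commute (phi p) (gx i)].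
Proof.
move=> /FbrP[n [T [S [p [hT hS pp ->]]]]]; exists n, p, T, S; split=> //.
- by rewrite -hT leaves_gt0.
- by rewrite hT.
- by rewrite (FeltE _ hT) -(phiE hT pp) -(f_dclass_mul hT hT hS pp (@pure1 n)) mulg1.
by rewrite -(phiE hT pp) => i; exact: diagonal_gx.
Qed.
End Image.

(** * Generators of the pure braid groups *)

Inductive generated (G : groupType) (S : G -> Prop) : G -> Prop :=
| Gen1 : generated S 1
| GenIn x : S x -> generated S x
| GenM x y : generated S x -> generated S y -> generated S (x * y)
| GenV x : generated S x -> generated S x^-1.

Lemma generated_sub (G : groupType) (S S' : G -> Prop) x :
  (forall y, S y -> generated S' y) -> generated S x -> generated S' x.
Proof. by move=> SS'; elim=> *; by [exact: Gen1|exact: SS'|exact: GenM|exact: GenV]. Qed.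

Lemma generated_conj (G : groupType) (S : G -> Prop) g x :
  (forall y, S y -> generated S (g * y * g^-1)) ->
  generated S x -> generated S (g * x * g^-1).
Proof.
move=> SS; elim=> [|y /SS //|y z _ IHy _ IHz|y _ IH].
- by rewrite mulg1 mulgV; exact: Gen1.
- suff -> : g * (y * z) * g^-1 = g * y * g^-1 * (g * z * g^-1) by exact: GenM.
  by rewrite !mulgA mulgVK.
suff -> : g * y^-1 * g^-1 = (g * y * g^-1)^-1 by exact: GenV.
by rewrite !invMg invgK mulgA.
Qed.

Lemma generated_commute (G : groupType) (S : G -> Prop) (z x : G) :
  (forall y, S y -> commute z y) -> generated S x -> commute z x.
Proof.
move=> C; elim=> [|y /C //|y y' _ IH _ IH'|y _ IH].
- exact: commute1.
- exact: commuteM.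
- exact: commuteV.
Qed.

(** The product sigma_(a+d-1) ... sigma_a, moving the strand at [a] across the
    next [d] strands. *)
Fixpoint run n (a d : nat) : braid n :=
  if d is d'.+1 then gen n (a + d') true * run n a d' else 1.

(** The classical pure braid generator A(i, j) for [j = i + d + 1]; indexing by
    the number [d] of strands in between avoids truncated subtraction. *)
Definition pgen n (i d : nat) : braid n :=
  run n i.+1 d * (gen n i true * gen n i true) * (run n i.+1 d)^-1.

Section Runs.
Variable n : nat.
Local Notation s i := (gen n i true).
Local Notation run := (run n).
Local Notation pgen := (pgen n).

Lemma gen_comm i j : (i.+1 < j) || (j.+1 < i) -> s i * s j = s j * s i.
Proof. by case/orP => h; [|symmetry]; exact: gen_far. Qed.

Lemma runSr a d : run a d.+1 = run a.+1 d * s a.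
Proof.
elim: d => [|d IH]; first by rewrite /= addn0 mulg1 mul1g.
by rewrite /= -mulgA -IH addnS.
Qed.

Lemma run_far a d m : (m.+1 < a) || (a + d < m) -> commute (s m) (run a d).
Proof.
elim: d => [|d IH] h; first exact: commute1.
by apply: commuteM; [apply: gen_comm|apply: IH]; lia.
Qed.

(** A crossing of two of the strands that the moving strand passes can be carried
    across it. *)
Lemma run_shift a d k : a <= k -> k.+1 < a + d -> a + d < n ->
  s k * run a d = run a d * s k.+1.
Proof.
elim: d => [|d IH] ak kd dn; first by lia.
have [kd'|kd'] := ltnP k.+1 (a + d).
  by rewrite /= mulgA gen_comm ?kd' // -!mulgA IH //; lia.
case: d IH kd dn kd' => [|d] _ kd dn kd'; first by lia.
have -> : k = a + d by lia.
rewrite /= addnS !mulgA gen_adj; last by lia.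
by rewrite -!mulgA run_far //; lia.
Qed.

Lemma pgen_far i d k : (k.+1 < i) || ((i < k) && (k < i + d)) -> i + d.+1 < n ->
  commute (s k) (pgen i d).
Proof.
move=> h dn; have [ki|ki] := ltnP k.+1 i.
  have C : commute (s k) (run i.+1 d) by apply: run_far; lia.
  have C' : commute (s k) (s i) by apply: gen_comm; rewrite ki.
  by apply: commuteM; [apply: commuteM => //; exact: commuteM|exact: commuteV].
have E : s k * run i.+1 d = run i.+1 d * s k.+1 by apply: run_shift; lia.
have C' : commute (s k.+1) (s i) by apply: gen_comm; lia.
rewrite /commute /pgen 2!mulgA E -(mulgA (run _ _)).
have -> : s k.+1 * (s i * s i) = s i * s i * s k.+1 by exact: commuteM.
rewrite -!mulgA; do 3 congr (_ * _).
by apply: (mulgI (run i.+1 d)); rewrite mulgA -E -mulgA mulgV mulg1 mulKVg.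
Qed.

Lemma pgen_up i d : i + d.+2 < n ->
  s i * pgen i d.+1 = pgen i.+1 d * s i.
Proof.
move=> dn; have F : commute (s i) (run i.+2 d) by apply: run_far; lia.
have B : s i * s i.+1 * s i = s i.+1 * (s i * s i.+1) by rewrite gen_adj ?mulgA //; lia.
have S2 : s i * s i.+1 * (s i * s i) = s i.+1 * s i.+1 * (s i * s i.+1).
  by rewrite mulgA B -mulgA B !mulgA.
rewrite /pgen runSr; move: (run i.+2 d) F => r F.
apply: (mulIg (r * s i.+1)); rewrite -[LHS]mulgA mulgVK.
rewrite -(mulgA _ _ (r * s i.+1)) [s i * (r * _)]mulgA F.
by rewrite !mulgA F mulgVK -!mulgA (mulgA (s i)) S2 !mulgA.
Qed.

Lemma pgen_down i d : i + d.+2 < n ->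
  s i * pgen i.+1 d = (pgen i.+1 d)^-1 * pgen i d.+1 * pgen i.+1 d * s i.
Proof.
move=> dn; have F : commute (s i) (run i.+2 d) by apply: run_far; lia.
have B : s i * s i.+1 * s i = s i.+1 * s i * s i.+1 by apply: gen_adj; lia.
rewrite /pgen runSr; move: (run i.+2 d) F => r F.
have E : s i * (s i.+1 * s i.+1) = (s i.+1)^-1 * (s i * s i * s i.+1 * s i).
  apply: (mulgI (s i.+1)); rewrite mulKVg !mulgA -B -!mulgA; congr (_ * _).
  by rewrite !mulgA -B.
have Fv : s i * r^-1 = r^-1 * s i by apply: commuteV.
transitivity (r * (s i * (s i.+1 * s i.+1)) * r^-1); first by rewrite !mulgA F.
rewrite E !invMg !invgK !mulgA !mulgVK.
by rewrite -(mulgA _ r^-1) -Fv !mulgA.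
Qed.

(** The generators linking strand [m + 1] with an earlier strand; they generate
    the kernel of forgetting that strand. *)
Definition last_pgen m (b : braid n) : Prop :=
  exists2 i, i <= m & b = pgen i (m - i).

(** For a crossing away from both ends of the arc the generator is fixed;
    otherwise the result is the generator of a neighbouring arc, possibly
    conjugated by the original one. *)
Lemma last_pgen_conj m k e b : m.+1 < n -> k < m -> last_pgen m b ->
  generated (last_pgen m) (gen n k e * b * (gen n k e)^-1).
Proof.
move=> mn km [i im ->].
have gp j : j <= m -> generated (last_pgen m) (pgen j (m - j)).
  by move=> jm; apply: GenIn; exists j.
have fixed : commute (s k) (pgen i (m - i)) ->
    generated (last_pgen m) (gen n k e * pgen i (m - i) * (gen n k e)^-1).
  move=> C; suff -> : gen n k e * pgen i (m - i) = pgen i (m - i) * gen n k e.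
    by rewrite mulgK; exact: gp.
  by case: e; rewrite ?gen_false //; exact/commute_sym/commuteV/commute_sym.
have [far|near] := boolP ((k.+1 < i) || ((i < k) && (k < i + (m - i)))).
  by apply/fixed/pgen_far => //; lia.
clear fixed.
have up j : j < m -> s j * pgen j (m - j) = pgen j.+1 (m - j.+1) * s j.
  move=> jm; have -> : m - j = (m - j.+1).+1 by lia.
  by apply: pgen_up; lia.
have down j : j < m -> s j * pgen j.+1 (m - j.+1) =
    (pgen j.+1 (m - j.+1))^-1 * pgen j (m - j) * pgen j.+1 (m - j.+1) * s j.
  move=> jm; have -> : m - j = (m - j.+1).+1 by lia.
  by apply: pgen_down; lia.
have [ki|ik] : k = i \/ k.+1 = i by lia.
  subst k; case: e; first by rewrite up // mulgK; exact: gp.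
  have U := up _ km; have D := down _ km.
  move: (gp i im) (gp i.+1 km) U D; move: (pgen i _) (pgen i.+1 _).
  move=> x y gx gy U D; suff -> : gen n i false * x * (gen n i false)^-1 = x * y * x^-1.
    by apply: GenM; [exact: GenM|exact: GenV].
  rewrite gen_false invgK; apply: (mulgI (s i)); apply: (mulIg x).
  rewrite !mulgA mulgV mul1g mulgVK -(mulgA x) U.
  by rewrite -[RHS]mulgA D !mulgA mulgV mul1g.
subst i; have U := up _ km; have D := down _ km.
case: e; last by rewrite gen_false invgK -mulgA -U mulKg; apply: gp; lia.
rewrite D mulgK; apply: GenM; last exact: gp.
by apply: GenM; [apply/GenV; exact: gp|apply: gp; lia].
Qed.

Inductive low m : braid n -> Prop :=
| Low1 : low m 1
| LowM b i e : i < m -> low m b -> low m (b * gen n i e).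

Lemma low_top (b : braid n) : low n.-1 b.
Proof.
rewrite -[b]reprK; elim/last_ind: (repr b) => [|w [i e] IH]; first exact: Low1.
by rewrite -cats1 braid_pi_cat -genE; apply: LowM.
Qed.

Lemma low_conj m c b : m.+1 < n -> low m c -> generated (last_pgen m) b ->
  generated (last_pgen m) (c * b * c^-1).
Proof.
move=> mn lc; elim: lc b => [|{}c i e im _ IH] b gb.
  by rewrite mul1g invg1 mulg1.
have -> : c * gen n i e * b * (c * gen n i e)^-1 =
    c * (gen n i e * b * (gen n i e)^-1) * c^-1 by rewrite invMg !mulgA.
by apply: IH; apply: generated_conj gb => y; exact: last_pgen_conj.
Qed.

(** The runs ending at the last strand behave as coset representatives under
    multiplication by a letter: either they absorb it, or it passes to the left
    as a letter of index below [m], or it completes a square and thereby a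
    generator. *)
Lemma run_gen m j k e : m.+1 < n -> j <= m.+1 -> k <= m ->
  exists h c j', [/\ generated (last_pgen m) h, low m c, j' <= m.+1 &
    run j (m.+1 - j) * gen n k e = h * c * run j' (m.+1 - j')].
Proof.
move=> mn jm km; have gp i : i <= m -> generated (last_pgen m) (pgen i (m - i)).
  by move=> im; apply: GenIn; exists i.
have l1 i : i < m -> low m (gen n i e).
  by move=> im; rewrite -[gen n i e]mul1g; apply: LowM im (Low1 _).
have runE i : i <= m -> run i (m.+1 - i) = run i.+1 (m - i) * s i.
  by move=> im; rewrite subSn // runSr.
have pE i : i <= m -> run i (m.+1 - i) * s i = pgen i (m - i) * run i.+1 (m - i).
  by move=> im; rewrite runE // /pgen mulgVK -mulgA.
have [kj|jk|e1] := ltngtP k.+1 j.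
- exists 1, (gen n k e), j; split=> //; [exact: Gen1|apply: l1; lia|].
  rewrite mul1g; have C : commute (run j (m.+1 - j)) (s k).
    by apply/commute_sym/run_far; lia.
  by case: e {l1}; rewrite ?gen_false //; exact: commuteV.
- have [ejk|jk'] := eqVneq j k.
    subst j; case: e {l1}.
      exists (pgen k (m - k)), 1, k.+1; split; rewrite ?pE ?mulg1 //.
      - exact: gp.
      - exact: Low1.
    exists 1, 1, k.+1; split; [exact: Gen1|exact: Low1|by []|].
    by rewrite runE // gen_false mulgK !mul1g.
  (* The letter crosses the run and its index drops by one. *)
case: k jk jk' km => [|k] jk jk' km; first by lia.
  exists 1, (gen n k e), j; split=> //; [exact: Gen1|apply: l1; lia|].
  have E : s k * run j (m.+1 - j) = run j (m.+1 - j) * s k.+1.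
    by apply: run_shift; lia.
  rewrite mul1g; case: e {l1} => //; rewrite !gen_false.
  by apply: (mulgI (s k)); apply: (mulIg (s k.+1)); rewrite mulgA mulgVK E mulKVg.
subst j; case: e {l1}.
  exists 1, 1, k; split; [exact: Gen1|exact: Low1|by apply: leqW|].
  by rewrite !mul1g [RHS]runE // subSS.
exists (pgen k (m - k))^-1, 1, k; split; [exact/GenV/gp|exact: Low1|by apply: leqW|].
apply: (mulgI (pgen k (m - k))); rewrite mulg1 mulKVg subSS mulgA -pE //.
by rewrite gen_false mulgK.
Qed.

(** Combing of the last strand: up to generators around the last strand and
    braids with one strand fewer, only the bottom position [j] of the strand
    that ends last matters. *)
Lemma low_decompose m b : m.+1 < n -> low m.+1 b ->
  exists h c j, [/\ generated (last_pgen m) h, low m c, j <= m.+1 &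
    b = h * c * run j (m.+1 - j)].
Proof.
move=> mn; elim=> [|{}b k e km _ [h [c [j [gh lc jm ->]]]]].
  exists 1, 1, m.+1; rewrite subnn !mul1g; split=> //; [exact: Gen1|exact: Low1].
(* Move the new generators in front of c by conjugation. *)
have [h' [c' [j' [gh' lc' jm' E]]]] := run_gen e mn jm km.
exists (h * (c * h' * c^-1)), (c * c'), j'; split=> //.
- by apply: GenM gh _; exact: low_conj.
- by clear E; elim: lc' => [|{}c' i e' im _ IH]; rewrite ?mulg1 // mulgA; apply: LowM.
by rewrite -(mulgA (h * c)) E !mulgA mulgVK.
Qed.
End Runs.

(** * Purity and the cloning of generators *)

Lemma rho_run n a d (k : 'I_n) : a + d < n ->
  rho (run n a d) k =
  (if k == a :> nat then a + d else if a < k <= a + d then k.-1 else k) :> nat.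
Proof.
elim: d => [|d IH] dn /=.
  by rewrite rho1 perm1; case: eqP => [->|]; [rewrite addn0|case: ifP => //; lia].
rewrite rhoM permM rho_gen; last by lia.
by rewrite IH /tp; [do ![case: ifP]; lia|lia].
Qed.

Lemma pure_gen2 n i : i < n.-1 -> pure (gen n i true * gen n i true).
Proof.
move=> lt_i; apply/permP => k; apply: ord_inj.
by rewrite rhoM permM !rho_gen // tpK perm1.
Qed.

Lemma pure_conj n (b c : braid n) : pure c -> pure (b * c * b^-1).
Proof. by rewrite /pure !rhoM => ->; rewrite rhoV mul1g mulVg. Qed.

Lemma pure_pgen n i d : i + d.+1 < n -> pure (pgen n i d).
Proof. by move=> dn; apply/pure_conj/pure_gen2; lia. Qed.

Definition is_pgen n (b : braid n) : Prop :=
  exists i d, i + d.+1 < n /\ b = pgen n i d.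

Lemma pure_generated_sub n (S : braid n -> Prop) b :
  (forall c, S c -> pure c) -> generated S b -> pure b.
Proof.
move=> pS; elim=> [|c /pS //|c d _ pc _ pd|c _ pc].
- exact: pure1.
- exact: pureM.
- exact: pureV.
Qed.

Lemma low_fix n m (c : braid n) (k : 'I_n) : m < n -> m < k -> low m c -> rho c k = k.
Proof.
move=> mn mk lc; apply: ord_inj; elim: lc => [|{}c i e im _ IH].
  by rewrite rho1 perm1.
rewrite rhoM permM; suff -> : rho (gen n i e) k = k by [].
by apply: ord_inj; rewrite rho_gen /tp; [do ![case: ifP]; lia|lia].
Qed.

(** In the decomposition of a pure braid the last strand returns to its place,
    so the run is trivial and the middle factor is pure with one strand fewer. *)
Lemma pure_low n m b : m < n -> low m b -> pure b -> generated (@is_pgen n) b.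
Proof.
elim: m b => [|m IH] b mn lb pb.
  suff -> : b = 1 by exact: Gen1.
  by case: lb.
have [h [c [j [gh lc jm E]]]] := low_decompose mn lb.
have gh' : generated (@is_pgen n) h.
  apply: generated_sub gh => _ [i im ->]; apply: GenIn; exists i, (m - i).
  by split=> //; lia.
have ph : pure h.
  by apply: pure_generated_sub gh' => _ [i [d [dn ->]]]; exact: pure_pgen.
have jn : j < n by lia.
pose k := Ordinal jn; pose t := Ordinal mn.
(* Follow the strand with bottom position j. *)
have rk : rho (run n j (m.+1 - j)) k = t.
  by apply: ord_inj; rewrite rho_run /= ?eqxx; lia.
have /permP/(_ k) : rho b = 1 by exact: pb.
rewrite E !rhoM !permM rk (low_fix _ _ lc) //; last by lia.
rewrite ph !perm1 => /(congr1 val) /= ej.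
rewrite -ej subnn mulg1; apply: GenM => //; apply: IH => //; first by lia.
have -> : c = h^-1 * b by rewrite E -ej subnn mulg1 mulKg.
by apply: pureM => //; exact: pureV.
Qed.

Lemma pure_generated n (b : braid n) : pure b -> generated (@is_pgen n) b.
Proof.
case: n b => [|n] b pb; last exact: (pure_low (ltnSn n) (low_top b)).
suff -> : b = 1 by exact: Gen1.
by elim/braid_ind: b pb => // -[[]].
Qed.

Lemma commute_run n a d (z : braid n) :
  (forall m, a <= m -> m < a + d -> commute z (gen n m true)) ->
  commute z (run n a d).
Proof.
elim: d => [|d IH] C; first exact: commute1.
by apply: commuteM; [apply: C; lia|apply: IH => m m1 m2; apply: C; lia].
Qed.

Section Cloning.
Variable n : nat.
Local Notation s i := (gen n.+1 i true).

Lemma kappa_run_lt a d (k : 'I_n) : a + d < n -> k < a ->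
  kappa k (run n a d) = run n.+1 a.+1 d.
Proof.
move=> + ka; elim: d => [|d IH] dn; first by rewrite kappa1.
rewrite /= kappaM kappa_gen; last by lia.
rewrite rho_run; last by lia.
rewrite IH; last by lia.
by congr (_ * _); rewrite /cl; do ![case: ifP; try lia]; rewrite addSn.
Qed.

Lemma kappa_run_gt a d (k : 'I_n) : a + d < n -> a + d < k ->
  kappa k (run n a d) = run n.+1 a d.
Proof.
elim: d => [|d IH] dn dk; first by rewrite kappa1.
rewrite /= kappaM kappa_gen; last by lia.
rewrite rho_run; last by lia.
rewrite IH; [|lia|lia].
by congr (_ * _); rewrite /cl; do ![case: ifP; try lia].
Qed.

Lemma kappa_run_mid a d (k : 'I_n) : a + d < n -> a < k <= a + d ->
  kappa k (run n a d) = run n.+1 a d.+1.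
Proof.
elim: d => [|d IH] dn dk; first by lia.
rewrite [run n a d.+1]/= kappaM kappa_gen; last by lia.
rewrite rho_run; last by lia.
have [kd|kd] := leqP k (a + d).
  rewrite IH; [|lia|lia].
  rewrite [RHS]/=; congr (_ * _).
  by rewrite /cl; do ![case: ifP; try lia]; rewrite addnS.
rewrite kappa_run_gt; [|lia|lia].
rewrite [RHS]/= mulgA addnS; congr (_ * _).
by rewrite /cl; do ![case: ifP; try lia].
Qed.

Lemma kappa_run_eq a d (k : 'I_n) : a + d < n -> k = a :> nat ->
  kappa k (run n a d) = run n.+1 a d * run n.+1 a.+1 d.
Proof.
move=> + ka; elim: d => [|d IH] dn; first by rewrite kappa1 mulg1.
rewrite [run n a d.+1]/= kappaM kappa_gen; last by lia.
rewrite rho_run; last by lia.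
rewrite IH; last by lia.
have F : commute (s (a + d).+1) (run n.+1 a d) by apply: run_far; lia.
rewrite ka eqxx /cl eqxx /= -!mulgA; congr (_ * _).
by rewrite !mulgA F addSn.
Qed.

Lemma kappa_conj (b c : braid n) (k : 'I_n) : pure c ->
  kappa (rho b k) (b * c * b^-1) = kappa k b * kappa k c * (kappa k b)^-1.
Proof.
move=> pc; rewrite kappaM kappaV rhoV permK kappaM.
by move: pc; rewrite /pure => ->; rewrite perm1.
Qed.

Lemma kappa_gen2 i (k : 'I_n) : i.+1 < n ->
  kappa k (gen n i true * gen n i true) =
  cl n.+1 (tp i k) i true * cl n.+1 k i true.
Proof. by move=> dn; rewrite kappaM !kappa_gen ?rho_gen //; lia. Qed.

Variables (i d : nat) (k : 'I_n).
Hypothesis dn : i + d.+1 < n.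

Let preim k' : rho (run n i.+1 d) k' = k ->
  kappa k (pgen n i d) = kappa k' (run n i.+1 d) *
    (cl n.+1 (tp i k') i true * cl n.+1 k' i true) * (kappa k' (run n i.+1 d))^-1.
Proof.
move=> <-; rewrite /pgen kappa_conj; last by apply: pure_gen2; lia.
by rewrite kappa_gen2 //; lia.
Qed.

Lemma kappa_pgen_lt : k < i -> kappa k (pgen n i d) = pgen n.+1 i.+1 d.
Proof.
move=> ki; rewrite (@preim k); last first.
  by apply: ord_inj; rewrite rho_run; [do ![case: ifP]; lia|lia].
rewrite kappa_run_lt; [|lia|lia].
by rewrite /cl /tp; do ![case: ifP; try lia].
Qed.

Lemma kappa_pgen_gt : i + d.+1 < k -> kappa k (pgen n i d) = pgen n.+1 i d.
Proof.
move=> ki; rewrite (@preim k); last first.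
  by apply: ord_inj; rewrite rho_run; [do ![case: ifP]; lia|lia].
rewrite kappa_run_gt; [|lia|lia].
by rewrite /cl /tp; do ![case: ifP; try lia].
Qed.

Lemma kappa_pgen_mid : i < k <= i + d -> kappa k (pgen n i d) = pgen n.+1 i d.+1.
Proof.
move=> ki; have kn : k.+1 < n by lia.
rewrite (@preim (Ordinal kn)); last first.
  by apply: ord_inj; rewrite rho_run /=; [do ![case: ifP]; lia|lia].
rewrite kappa_run_mid /=; [|lia|lia].
by rewrite /cl /tp; do ![case: ifP; try lia].
Qed.

Lemma kappa_pgen_right : k = i + d.+1 :> nat ->
  kappa k (pgen n i d) = pgen n.+1 i d * pgen n.+1 i d.+1.
Proof.
move=> ki; have kn : i.+1 < n by lia.
rewrite (@preim (Ordinal kn)); last first.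
  by apply: ord_inj; rewrite rho_run /=; [do ![case: ifP]; lia|lia].
rewrite kappa_run_eq /=; [|lia|lia].
have B : s i * s i.+1 * s i = s i.+1 * s i * s i.+1 by apply: gen_adj.
have -> : cl n.+1 (tp i i.+1) i true * cl n.+1 i.+1 i true =
    s i * s i * (s i.+1 * (s i * s i) * (s i.+1)^-1).
  rewrite /cl /tp; do ![case: ifP; try lia] => *.
  rewrite -!mulgA; congr (_ * _); apply: (mulIg (s i.+1)).
  rewrite !mulgA mulgVK B -!mulgA; congr (_ * _).
  by rewrite !mulgA B.
have F : commute (s i) (run n.+1 i.+2 d) by apply: run_far; lia.
have F' : commute (pgen n.+1 i d.+1) (run n.+1 i.+1 d).
  by apply: commute_run => m m1 m2; apply/commute_sym/pgen_far; lia.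
transitivity (run n.+1 i.+1 d * (s i * s i) * pgen n.+1 i d.+1 * (run n.+1 i.+1 d)^-1).
  have F2 : commute (s i * s i) (run n.+1 i.+2 d).
    by apply/commute_sym/commuteM; exact/commute_sym.
  rewrite /pgen runSr !invMg -!mulgA; congr (_ * _); rewrite !mulgA.
  by rewrite -(mulgA (run _ _ _) (s i) (s i)) -F2.
by rewrite -mulgA (commuteV F') mulgA.
Qed.

Lemma kappa_pgen_left : k = i :> nat ->
  kappa k (pgen n i d) = pgen n.+1 i d.+1 * pgen n.+1 i.+1 d.
Proof.
move=> ki; rewrite (@preim k); last first.
  by apply: ord_inj; rewrite rho_run; [do ![case: ifP]; lia|lia].
rewrite kappa_run_lt; [|lia|lia].
have -> : cl n.+1 (tp i k) i true * cl n.+1 k i true = s i.+1 * (s i * s i) * s i.+1.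
  by rewrite /cl /tp; do ![case: ifP; try lia]; rewrite !mulgA.
by rewrite /pgen runSr !invMg !mulgA !mulgVK.
Qed.
End Cloning.

(** * Clone-invariant families of homomorphisms *)

Section CloneInvariant.
Variables (Q : groupType) (phi : forall n, braid n -> Q).
Arguments phi {n}.
Hypothesis phiM : forall n (p q : braid n), pure p -> pure q -> phi (p * q) = phi p * phi q.
Hypothesis phi_kappa : forall n (k : 'I_n) (p : braid n), pure p -> phi (kappa k p) = phi p.

Let x n i d := phi (pgen n i d).

Lemma phi1 n : phi (1 : braid n) = 1.
Proof.
by apply: (mulgI (phi (1 : braid n))); rewrite -phiM ?mulg1 //; exact: pure1.
Qed.

Lemma phiV n (p : braid n) : pure p -> phi p^-1 = (phi p)^-1.
Proof.
by move=> pp; apply: (mulgI (phi p)); rewrite -phiM ?mulgV ?phi1 //; exact: pureV.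
Qed.

(** The first three relations come from cloning a strand outside the endpoints
    of the arc, the last two from cloning an endpoint. *)
Section Relations.
Variables (n i d : nat).
Hypothesis dn : i + d.+1 < n.

Lemma phi_pgen_before : 0 < i -> x n.+1 i.+1 d = x n i d.
Proof.
move=> i0; have k0 : 0 < n by lia.
by rewrite /x -(phi_kappa (Ordinal k0)) ?kappa_pgen_lt //; exact: pure_pgen.
Qed.

Lemma phi_pgen_after : i + d.+2 < n -> x n.+1 i d = x n i d.
Proof.
move=> dn'; rewrite /x -(phi_kappa (Ordinal dn')) ?kappa_pgen_gt //=; try lia.
exact: pure_pgen.
Qed.

Lemma phi_pgen_between : 0 < d -> x n.+1 i d.+1 = x n i d.
Proof.
move=> d0; have kn : i.+1 < n by lia.
rewrite /x -(phi_kappa (Ordinal kn)) ?kappa_pgen_mid //=; try lia.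
exact: pure_pgen.
Qed.

Lemma phi_pgen_right : x n i d = x n.+1 i d * x n.+1 i d.+1.
Proof.
rewrite /x -(phi_kappa (Ordinal dn)) ?kappa_pgen_right //; last exact: pure_pgen.
by rewrite phiM //; apply: pure_pgen; lia.
Qed.

Lemma phi_pgen_left : x n i d = x n.+1 i d.+1 * x n.+1 i.+1 d.
Proof.
have kn : i < n by lia.
rewrite /x -(phi_kappa (Ordinal kn)) ?kappa_pgen_left //; last exact: pure_pgen.
by rewrite phiM //; apply: pure_pgen; lia.
Qed.
End Relations.

(** Cloning the right end of a shorter arc produces a copy of the same arc and
    this one, while cloning a strand further right produces only the copy. *)
Lemma phi_pgen_inner_left n i d : i + d.+3 < n -> x n i d.+1 = 1.
Proof.
case: n => // n dn; apply: (mulgI (x n.+1 i d)).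
rewrite mulg1 -phi_pgen_right; last by lia.
by rewrite phi_pgen_after //; lia.
Qed.

(** Mirror image of the argument of [phi_pgen_inner_left]. *)
Lemma phi_pgen_inner_right n i d : i.+1 + d.+2 < n -> x n i.+1 d.+1 = 1.
Proof.
case: n => // n dn; apply: (mulIg (x n.+1 i.+2 d)).
rewrite mul1g -phi_pgen_left; last by lia.
by rewrite phi_pgen_before //; lia.
Qed.

Lemma phi_pgen_outer n : x n.+3 0 n.+1 = x 3 0 1.
Proof. by elim: n => // n IH; rewrite phi_pgen_between. Qed.

(** Once the longer arcs of [phi_pgen_inner_left] and [phi_pgen_inner_right] are
    trivial, cloning an endpoint of an adjacent arc also just shifts it. Three
    strands at least are required: with two, the arc is adjacent and outermost
    at the same time. *)
Lemma phi_pgen_adjacent n i : i.+1 < n.+3 -> x n.+3 i 0 = x 3 0 0.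
Proof.
have up m j : j.+1 < m.+3 -> x m.+4 j.+1 0 = x m.+3 j 0.
  case: j => [|j] jm; last by apply: phi_pgen_before; lia.
  by rewrite [RHS]phi_pgen_left // phi_pgen_inner_left // mul1g.
have same m j : j.+1 < m.+3 -> x m.+4 j 0 = x m.+3 j 0.
  rewrite ltnS leq_eqVlt => /orP[/eqP [->]|jm]; last by apply: phi_pgen_after; lia.
  by rewrite [RHS]phi_pgen_right ?addn1 // phi_pgen_inner_right ?mulg1 //; lia.
elim: n i => [|n IH] i ni.
  by case: i ni => [|[|i]] // _; rewrite -same // up.
by case: i ni => [|i] ni; [rewrite same // IH|rewrite up // IH].
Qed.

(** Represent the two classes with four strands by the outermost arc and the
    middle adjacent arc, which are nested. *)
Lemma phi_pgen_outer_adjacent : commute (x 3 0 1) (x 3 0 0).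
Proof.
rewrite -(phi_pgen_outer 1) -(@phi_pgen_adjacent 1 1) // /x.
have p1 : pure (pgen 4 0 2) by apply: pure_pgen.
have p2 : pure (pgen 4 1 0) by apply: pure_pgen.
rewrite /commute -!phiM //; congr phi.
have C : commute (pgen 4 0 2) (gen 4 1 true) 
  by apply: commute_sym; apply: (@pgen_far 4 0 2 1).
have -> : pgen 4 1 0 = gen 4 1 true * gen 4 1 true.
  by rewrite /pgen /= invg1 mulg1 mul1g.
exact: commuteM.
Qed.

Definition basic (u : Q) : Prop := u = x 3 0 0 \/ u = x 3 0 1.

Lemma phi_basic n (p : braid n) : 0 < n -> pure p -> generated basic (phi p).
Proof.
(* Cloning twice reaches three strands without changing the image. *)
wlog n3 : n p / 2 < n => [H n0 pp|_ pp].
  have step m (q : braid m) (k : 'I_m) : pure q ->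
     generated basic (phi (kappa k q)) -> generated basic (phi q).
    by move=> pq; rewrite phi_kappa.
  case: n n0 p pp => [//|n] _ p pp.
  apply: (step _ _ ord0 pp); have pp' := pure_kappa ord0 pp.
  apply: (step _ _ ord0 pp'); have pp'' := pure_kappa ord0 pp'.
  exact: H.
have pp' := pure_generated pp.
elim: {p pp} pp' => [|_ [i [d [dn ->]]]|p q gp IHp gq IHq|p gp IH].
- by rewrite phi1; exact: Gen1.
- case: n n3 dn => [|[|[|n]]] // _ dn; rewrite -/(x n.+3 i d).
  case: d dn => [|d] dn; first by rewrite phi_pgen_adjacent ?addn1 //; [apply: GenIn; left|lia].
  case: i dn => [|i] dn; last by rewrite phi_pgen_inner_right //; exact: Gen1.
  have [dn'|dn'] := ltnP d.+3 n.+3; first by rewrite phi_pgen_inner_left //; exact: Gen1.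
  have -> : d = n by lia.
  by rewrite phi_pgen_outer; apply: GenIn; right.
- have pp m : forall q : braid m, generated (@is_pgen m) q -> pure q.
    by move=> q'; apply: pure_generated_sub => _ [i [d [dn ->]]]; exact: pure_pgen.
  by rewrite phiM; [exact: GenM|exact: pp|exact: pp].
rewrite phiV; first exact: GenV.
by apply: pure_generated_sub gp => _ [i [d [dn ->]]]; exact: pure_pgen.
Qed.

Lemma phi_comm n m (p : braid n) (q : braid m) : 0 < n -> 0 < m ->
  pure p -> pure q -> commute (phi p) (phi q).
Proof.
move=> n0 m0 pp pq; have C := phi_pgen_outer_adjacent.
apply: (generated_commute _ (phi_basic m0 pq)) => y By; apply: commute_sym.
apply: (generated_commute _ (phi_basic n0 pp)) => z Bz.
by case: By Bz => -> [] ->; [exact: commute_refl|exact: commute_sym|exact: C|exact: commute_refl].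
Qed.
End CloneInvariant.

Theorem theorem2p1 (N : set Vbr) :
  is_normal_subgroup Fbr N ->
  N `<=` Pbr \/ commutator_subgroup Fbr Fbr `<=` N.
Proof.
move=> nN; have [Q [f [fM fN]]] := normal_quotient Fbr_subgroup nN.
have [NP|notNP] := pselect (N `<=` Pbr); [by left|right].
have gx12 : gx f 1 = gx f 2.
  apply: contrapT => ne; apply: notNP => x Nx.
  have Fx : Fbr x by case: nN => _ + _; exact.
  have := (fN _ Fx).2 Nx.
  have [n [T [S [p [hT hS pp ->]]]]] := FbrP Fx.
  have [<- _|TS fx] := pselect (T = S); first exact: dclass_sub_Pbr.
  by case: ne; exact: (kernel_gx fM hT hS pp TS fx).
have sN : is_subgroup N by case: nN.
apply: smallest_sub => // _ [h Fh] [k Fk <-].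
have Fbr_div y z : Fbr y -> Fbr z -> Fbr (y * z^-1).
  by case/is_subgroupP: Fbr_subgroup => _; exact.
have Fbr_mul y z : Fbr y -> Fbr z -> Fbr (y * z).
  move=> Fy Fz; rewrite -[z]invgK; apply: (Fbr_div) => //.
  by rewrite -[z^-1]mul1g; apply: (Fbr_div) => //; case/is_subgroupP: Fbr_subgroup.
have Fc : Fbr [~ h, k].
  have -> : [~ h, k] = (k * h)^-1 * (h * k) by rewrite (commgC h k) mulKg.
  rewrite -[(k * h)^-1]mul1g; apply: (Fbr_mul); last exact: Fbr_mul.
  by apply: (Fbr_div); [case/is_subgroupP: Fbr_subgroup|exact: Fbr_mul].
apply/(fN _ Fc); apply: (mulgI (f (k * h))).
rewrite -fM //; last exact: Fbr_mul.
rewrite -(commgC h k) mulg1 !fM //.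
have [n [p [T [S [n0 pp hTS -> px]]]]] := Fbr_image fM gx12 Fh.
have [m [q [T' [S' [m0 pq hTS' -> qx]]]]] := Fbr_image fM gx12 Fk.
have Cpq := phi_comm (phiM fM) (phi_kappa fM gx12) n0 m0 pp pq.
have FC (u : Q) A B : leaves A = leaves B -> (forall i, commute u (gx f i)) ->
    commute u (f (Felt A B)) by move=> h' ux; exact: commute_Felt.
have gF i : commute (f (Felt T S)) (gx f i).
  by apply/commute_sym/FC => // j; exact: gx_comm.
apply: commuteM.
  by apply/commute_sym/commuteM; [exact/commute_sym|exact: FC].
by apply/commute_sym/commuteM; apply/commute_sym/FC.
Qed.
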